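(* The Greedy Algorithm (described in the context) for the problem ''Merging to minimum $k$-interval bigraph ordering'' is correct, that is, on every input it outputs the minimum $k$ such that the two given orders can be merged into a $k$-interval ordering of $\mathrm{cla}\cup\mathrm{var}$. Moreover, it can be implemented to run in time $O(|E|\log k)$, where $k$ is the output value.
   Context: A bipartite graph is written $G=(\mathrm{cla},\mathrm{var},E)$; vertices of $\mathrm{cla}$ are called clauses, vertices of $\mathrm{var}$ variables, and a variable $x$ appears in a clause $C$ if $xC\in E$. For a total order $<$ on $\mathrm{cla}\cup\mathrm{var}$ and a clause $C$, let $\mathrm{EdgesAdded}(C)$ be the number of variables $x$ not appearing in $C$ for which at least one of the following holds: (1) some variable $x'$ appears in $C$ with $x'<x<C$; (2) $x$ appears in some clause $C'$ with $C'<C<x$. For an integer $k\ge 0$, the order is a $k$-interval ordering if $\mathrm{EdgesAdded}(C)\le k$ for every clause $C$. Problem ''Merging to minimum $k$-interval bigraph ordering''. Input: a bipartite graph $G=(\mathrm{cla},\mathrm{var},E)$, a total order $c_1,\dots,c_m$ of $\mathrm{cla}$ and a total order $x_1,\dots,x_n$ of $\mathrm{var}$. Output: the minimum $k$ such that the two orders can be merged into a $k$-interval ordering of $\mathrm{cla}\cup\mathrm{var}$ (a merge is a total order on $\mathrm{cla}\cup\mathrm{var}$ whose restrictions to $\mathrm{cla}$ and $\mathrm{var}$ are the given orders). Greedy Algorithm. For $q=0,1,2,\dots$: start with the ordering $x_1,\dots,x_n$; for $i=m$ down to $1$, insert $c_i$ at the highest position among the variables, below $c_{i+1}$ (no upper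 restriction if $i=m$; $c_i$ may be placed immediately below $c_{i+1}$ in the same gap between variables), for which $\mathrm{EdgesAdded}(c_i)\le q$; if no such position exists, abandon this $q$ and go on to $q+1$. If all clauses have been inserted, output $q$ and stop. Here $\mathrm{EdgesAdded}(c_i)$ is evaluated for the given position of $c_i$ among the variables with $c_1,\dots,c_{i-1}$ below $c_i$ and $c_{i+1},\dots,c_m$ above $c_i$; it does not depend on where exactly these other clauses are placed. An implementation may search for the minimum successful $q$ in any way (e.g. not by trying all values consecutively). In the running time, $\log k$ is to be read as $\log(k+2)$, so that it is meaningful for $k\in\{0,1\}$. *)

(* Defs.v *)
From mathcomp Require Import all_boot.

Set Implicit Arguments.
Unset Strict Implicit.
Unset Printing Implicit Defensive.

Section Orderings.

(* A bipartite graph: (C, x) \in E means that variable x appears in clause C. *)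
Variables (cla var : finType) (E : {set cla * var}).

Definition strict_total_order (T : eqType) (lt : rel T) : Prop :=
  [/\ irreflexive lt, transitive lt & forall a b, a != b -> lt a b || lt b a].

Definition edges_added (lt : rel (cla + var)) (C : cla) : nat :=
  #|[set x | ((C, x) \notin E) &&
      ([exists x', [&& (C, x') \in E, lt (inr x') (inr x)
                     & lt (inr x) (inl C)]]
    || [exists C', [&& (C', x) \in E, lt (inl C') (inl C)
                     & lt (inl C) (inr x)]])]|.

Definition k_interval (k : nat) (lt : rel (cla + var)) : Prop :=
  strict_total_order lt /\ forall C, edges_added lt C <= k.

(* The given orders c_1, ..., c_m and x_1, ..., x_n, as listings. *)
Variables (cs : seq cla) (xs : seq var).

Definition before (T : eqType) (s : seq T) : rel T :=
  fun a b => index a s < index b s.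

Definition is_merge (lt : rel (cla + var)) : Prop :=
  [/\ strict_total_order lt,
      forall C C', lt (inl C) (inl C') = before cs C C'
    & forall x x', lt (inr x) (inr x') = before xs x x'].

Definition mergeable (k : nat) : Prop :=
  exists lt, is_merge lt /\ k_interval k lt.

Definition min_mergeable (k : nat) : Prop :=
  mergeable k /\ forall k', mergeable k' -> k <= k'.

(* The position of a clause is the number p of variables below it. Since
   EdgesAdded(c_i) depends only on the position of c_i and on the other clauses
   being on the correct side of c_i, it is evaluated with all of them put in
   the same gap as c_i. *)
Definition trial (p : nat) : rel (cla + var) :=
  before ([seq inr x | x <- take p xs] ++ [seq inl C | C <- cs]
            ++ [seq inr x | x <- drop p xs]).

(* Highest admissible position of C among those not above ub. *)
Definition highest (q : nat) (C : cla) (ub : nat) : option nat :=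
  ohead [seq p <- rev (iota 0 ub.+1) | edges_added (trial p) C <= q].

(* Inserts the clauses of the list in turn, each at most as high as the
   preceding one; None means that this q is abandoned. *)
Fixpoint insert_all (q : nat) (todo : seq cla) (ub : nat) : option (seq nat) :=
  if todo is C :: todo' then
    if highest q C ub is Some p then omap (cons p) (insert_all q todo' p)
    else None
  else Some [::].

Definition greedy_round (q : nat) : option (seq nat) :=
  insert_all q (rev cs) (size xs).

Inductive greedy_from (q : nat) : nat -> Prop :=
| GreedyStop of isSome (greedy_round q) : greedy_from q q
| GreedyNext k of greedy_round q = None & greedy_from q.+1 k : greedy_from q k.

Definition greedy_outputs (k : nat) : Prop := greedy_from 0 k.

End Orderings.

(* Word RAM: registers and arrays of words, both named by constants of the
   program. Every constant, register access, array access, arithmetic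
   operation, assignment and test takes unit time. *)

Inductive expr :=
| Num of nat
| Reg of nat
| Cell of nat & expr
| Plus of expr & expr
| Minus of expr & expr
| Half of expr.

Inductive prog :=
| Skip
| Assign of nat & expr
| Store of nat & expr & expr
| Seq of prog & prog
| IfLeq of expr & expr & prog & prog
| WhileLeq of expr & expr & prog.

Record state := State { reg : nat -> nat; arr : nat -> nat -> nat }.

Definition set_reg (s : state) (r v : nat) : state :=
  State (fun r' => if r' == r then v else reg s r') (arr s).

Definition set_cell (s : state) (a i v : nat) : state :=
  State (reg s)
    (fun a' i' => if (a' == a) && (i' == i) then v else arr s a' i').

Fixpoint eval (s : state) (e : expr) : nat :=
  match e with
  | Num v => v
  | Reg r => reg s r
  | Cell a e1 => arr s a (eval s e1)
  | Plus e1 e2 => eval s e1 + eval s e2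
  | Minus e1 e2 => eval s e1 - eval s e2
  | Half e1 => (eval s e1)./2
  end.

Fixpoint cost (e : expr) : nat :=
  match e with
  | Num _ | Reg _ => 1
  | Cell _ e1 | Half e1 => (cost e1).+1
  | Plus e1 e2 | Minus e1 e2 => (cost e1 + cost e2).+1
  end.

(* All values met while evaluating e are words, i.e. smaller than W. *)
Fixpoint fits (W : nat) (s : state) (e : expr) : bool :=
  (eval s e < W) &&
  match e with
  | Num _ | Reg _ => true
  | Cell _ e1 | Half e1 => fits W s e1
  | Plus e1 e2 | Minus e1 e2 => fits W s e1 && fits W s e2
  end.

(* exec W P s t s': with words smaller than W, the program P started in s stops
   in s' after t steps; there is no execution if a value overflows. *)
Inductive exec (W : nat) : prog -> state -> nat -> state -> Prop :=
| ExecSkip s :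
    exec W Skip s 1 s
| ExecAssign s r e of fits W s e :
    exec W (Assign r e) s (cost e).+1 (set_reg s r (eval s e))
| ExecStore s a e1 e2 of fits W s e1 & fits W s e2 :
    exec W (Store a e1 e2) s (cost e1 + cost e2).+1
      (set_cell s a (eval s e1) (eval s e2))
| ExecSeq P1 P2 s s1 s2 t1 t2 of exec W P1 s t1 s1 & exec W P2 s1 t2 s2 :
    exec W (Seq P1 P2) s (t1 + t2) s2
| ExecIf e1 e2 P1 P2 s s' t of fits W s e1 & fits W s e2
    & exec W (if eval s e1 <= eval s e2 then P1 else P2) s t s' :
    exec W (IfLeq e1 e2 P1 P2) s ((cost e1 + cost e2).+1 + t) s'
| ExecWhileStop e1 e2 P s of fits W s e1 & fits W s e2
    & eval s e2 < eval s e1 :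
    exec W (WhileLeq e1 e2 P) s (cost e1 + cost e2).+1 s
| ExecWhileStep e1 e2 P s s1 s2 t1 t2 of fits W s e1 & fits W s e2
    & eval s e1 <= eval s e2
    & exec W P s t1 s1 & exec W (WhileLeq e1 e2 P) s1 t2 s2 :
    exec W (WhileLeq e1 e2 P) s ((cost e1 + cost e2).+1 + t1 + t2) s2.

Section Input.

Variables (cla var : finType) (E : {set cla * var}).
Variables (cs : seq cla) (xs : seq var).

(* The adjacency lists of the clauses, concatenated in the order of cs, and
   those of the variables, concatenated in the order of xs. *)
Definition edges_by_clause : seq (cla * var) :=
  [seq e <- [seq (C, x) | C <- cs, x <- xs] | e \in E].

Definition edges_by_variable : seq (cla * var) :=
  [seq e <- [seq (C, x) | x <- xs, C <- cs] | e \in E].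

(* Vertices are encoded by their 0-based ranks in the given orders. Unused
   registers and cells contain 0. *)
Definition input : state :=
  State
    (nth 0 [:: size cs; size xs; #|E|])
    (fun a => nth 0 (nth [::]
       [:: [seq index e.1 cs | e <- edges_by_clause];
           [seq index e.2 xs | e <- edges_by_clause];
           [seq index e.1 cs | e <- edges_by_variable];
           [seq index e.2 xs | e <- edges_by_variable]] a)).

(* The output is the final content of register 0. *)
Definition computes_in_time (W : nat) (P : prog) (k T : nat) : Prop :=
  exists t s, [/\ exec W P input t s, reg s 0 = k & t <= T].

End Input.

(* Main.v *)
Require Import Defs.
From mathcomp Require Import all_boot zify.

Set Implicit Arguments.
Unset Strict Implicit.
Unset Printing Implicit Defensive.

(* Correctness: EdgesAdded(C) depends only on the position of C, so a merge is
   a monotone choice of positions. Any feasible choice stays below the greedy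
   one, hence a round succeeds as soon as some merge exists for its q; success
   is then monotone in q.

   Running time: the variables not appearing in C that are added at position p,
   together with the deg(C) neighbours of C, form the set of all variables x
   with first(C) <= x < p, or with p <= x and x adjacent to a clause of rank at
   most that of C. So EdgesAdded(C) + deg(C) = (p - first(C)) + D(p), where D
   changes by at most one when a single edge of C is discarded, or when p jumps
   down to the next variable that has an edge. While p > first(C), lowering p
   never increases EdgesAdded(C); once p <= first(C), it never decreases it.
   Runs of isolated variables are jumped over by arithmetic, and an isolated
   clause goes to the current position iff D <= q there. One round therefore
   costs O(|E| + 1), and q is found by galloping followed by bisection. *)

(** * Merges as monotone choices of positions *)

Section Merging.

Variables (cla var : finType) (E : {set cla * var}).
Variables (cs : seq cla) (xs : seq var).
Hypotheses (cs_perm : perm_eq cs (enum cla)) (xs_perm : perm_eq xs (enum var)).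

Lemma mem_listing (T : finType) (s : seq T) x : perm_eq s (enum T) -> x \in s.
Proof. by move=> /perm_mem ->; rewrite mem_enum. Qed.

Lemma uniq_listing (T : finType) (s : seq T) : perm_eq s (enum T) -> uniq s.
Proof. by move=> /perm_uniq ->; rewrite enum_uniq. Qed.

Lemma index_listing_inj (T : finType) (s : seq T) :
  perm_eq s (enum T) -> injective (index^~ s).
Proof. by move=> sP x y; apply: (index_inj x); apply: mem_listing. Qed.

(** EdgesAdded as a function of the position alone, the common measure for merges and for the trials
    of the greedy algorithm. *)
Definition added_at (C : cla) (p : nat) : nat :=
  #|[set x | ((C, x) \notin E) &&
      ([exists x', [&& (C, x') \in E, index x' xs < index x xs
                     & index x xs < p]]
    || [exists C', [&& (C', x) \in E, index C' cs < index C cs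
                     & p <= index x xs]])]|.

Lemma edges_added_at (lt : rel (cla + var)) C p :
  (forall C C', lt (inl C) (inl C') = before cs C C') ->
  (forall x x', lt (inr x) (inr x') = before xs x x') ->
  (forall x, lt (inr x) (inl C) = (index x xs < p)) ->
  (forall x, lt (inl C) (inr x) = (p <= index x xs)) ->
  edges_added E lt C = added_at C p.
Proof.
move=> hcc hxx hxc hcx; apply: eq_card => x; rewrite !inE.
congr (_ && (_ || _)).
  by apply: eq_existsb => x'; rewrite hxx hxc.
by apply: eq_existsb => C'; rewrite hcc hcx.
Qed.

Lemma edges_added_trial C p :
  p <= size xs -> edges_added E (trial cs xs p) C = added_at C p.
Proof.
move=> ple; have inl_inj : injective (@inl cla var) by move=> ? ? [].
have inr_inj : injective (@inr cla var) by move=> ? ? [].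
have inlF C' s : (inl C' \in [seq @inr cla var x | x <- s]) = false.
  by apply/negbTE/mapP=> -[].
have inrF x s : (inr x \in [seq @inl cla var C' | C' <- s]) = false.
  by apply/negbTE/mapP=> -[].
have ixl C' : index (inl C') ([seq inr x | x <- take p xs]
   ++ [seq inl C | C <- cs] ++ [seq inr x | x <- drop p xs]) = p + index C' cs.
  rewrite index_cat inlF index_cat map_f ?mem_listing // index_map //.
  by rewrite size_map size_takel.
have ixr x : index (inr x) ([seq inr x | x <- take p xs]
   ++ [seq inl C | C <- cs] ++ [seq inr x | x <- drop p xs]) =
   if index x xs < p then index x xs else size cs + index x xs.
  rewrite index_cat mem_map // in_take ?mem_listing // index_map //.
  have xin := mem_listing x xs_perm.
  have : index x xs = index x (take p xs ++ drop p xs) by rewrite cat_take_drop.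
  rewrite index_cat in_take //; case: ifP => // xp.
  by rewrite index_cat inrF index_map // !size_map size_takel //; lia.
have lt_cs C' : index C' cs < size cs by rewrite index_mem mem_listing.
apply: edges_added_at => *; rewrite /trial /before ?ixl ?ixr //.
- lia.
- by case: ifP; case: ifP; lia.
- have := lt_cs C; case: ifP; lia.
- have := lt_cs C; case: ifP; lia.
Qed.

Lemma highest_spec q C ub : ub <= size xs ->
  match highest E cs xs q C ub with
  | Some p => [/\ p <= ub, added_at C p <= q
                & forall p', p < p' <= ub -> q < added_at C p']
  | None => forall p', p' <= ub -> q < added_at C p'
  end.
Proof.
rewrite /highest; elim: ub => [|ub IH] leub.
  rewrite /= edges_added_trial //; case: leqP => /= h.
    by split => // p'; lia.
  by move=> p'; rewrite leqn0 => /eqP ->.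
have -> : iota 0 ub.+2 = rcons (iota 0 ub.+1) ub.+1.
  by rewrite -[in LHS]addn1 iotaD cats1.
rewrite rev_rcons /= edges_added_trial //; case: leqP => /= h.
  by split => // p'; lia.
have := IH (ltnW leub); case: (ohead _) => [p [h1 h2 h3]|h1].
  split => // [|p' /andP [pp']]; first lia.
  by rewrite leq_eqVlt => /orP [/eqP ->//|h4]; apply: h3; lia.
by move=> p'; rewrite leq_eqVlt => /orP [/eqP ->//|h4]; apply: h1; lia.
Qed.

Lemma added_at_max C p : added_at C p <= size xs.
Proof.
rewrite (perm_size xs_perm) -cardE; apply: max_card.
Qed.

(** The greedy choice stays ahead: [pos C] is itself admissible and not above [ub], so the highest
    admissible position is at least [pos C], and therefore leaves room for [pos] of every later
    clause of the list. *)
Lemma insert_all_some q (pos : cla -> nat) todo ub :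
  ub <= size xs -> (forall C, added_at C (pos C) <= q) ->
  sorted (fun C C' => pos C' <= pos C) todo ->
  (forall C, C \in todo -> pos C <= ub) -> isSome (insert_all E cs xs q todo ub).
Proof.
move=> + hpos; elim: todo ub => //= C todo IH ub leub tsorted tub.
have := highest_spec q C leub; case: highest => [p [h1 h2 h3]|h1]; last first.
  by have := h1 _ (tub C (mem_head _ _)); rewrite ltnNge hpos.
have pC : pos C <= p.
  rewrite leqNgt; apply/negP => h.
  by have := h3 (pos C); rewrite h (tub C (mem_head _ _)) ltnNge hpos => /(_ isT).
suff : isSome (insert_all E cs xs q todo p) by case: insert_all.
apply: IH; first lia.
  exact: path_sorted tsorted.
move=> C' C'in; apply: leq_trans pC.
move: tsorted; rewrite path_sortedE; last by move=> ? ? ? h h'; apply: leq_trans h' h.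
by case/andP => /allP /(_ C' C'in).
Qed.

(** By transitivity the variables below a clause form an initial segment of [xs], so a merge is
    recorded by the lengths of these segments. Conversely, clauses that share a gap are put in the
    order of [cs]. *)
Lemma mergeable_positions k :
  mergeable E cs xs k <->
  exists pos : cla -> nat,
    [/\ forall C, pos C <= size xs,
        forall C C', index C cs < index C' cs -> pos C <= pos C'
      & forall C, added_at C (pos C) <= k].
Proof.
have inj_cs := index_listing_inj cs_perm; have inj_xs := index_listing_inj xs_perm.
split=> [[lt [[[irr tr tot] hcc hxx] [_ hk]]]|[pos [posle posmono hk]]].
  have asym a b : lt a b -> lt b a = false.
    by move=> h; apply/negP => h'; have := tr _ _ _ h h'; rewrite irr.
  pose pos C := find (fun x => ~~ lt (inr x) (inl C)) xs.
  have posE C x : lt (inr x) (inl C) = (index x xs < pos C).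
    have xin := mem_listing x xs_perm.
    case: ltnP => [/(before_find x)|]; first by rewrite nth_index //= => /negbFE.
    move=> posx; have := posx.
    rewrite leq_eqVlt => /orP [/eqP eq_pos|posx'].
      apply/negbTE; rewrite -(nth_index x xin) -eq_pos.
      by apply: (@nth_find _ x (fun x => ~~ lt (inr x) (inl C))); rewrite has_find -/(pos C) eq_pos index_mem.
    (* Here [x] comes after the first variable that is not below [C]; were [x] below [C],
       transitivity would put that variable below [C] as well. *)
    have possz : pos C < size xs by apply: leq_ltn_trans posx _; rewrite index_mem.
    have ny : ~~ lt (inr (nth x xs (pos C))) (inl C).
      by apply: (@nth_find _ x (fun x => ~~ lt (inr x) (inl C))); rewrite has_find.
    apply: contraNF ny => /(tr _ _ _ _); apply; rewrite hxx /before.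
    by rewrite index_uniq // uniq_listing.
  exists pos; split=> [C|C C' CC'|C]; first exact: find_size.
    rewrite leqNgt; apply/negP => h.
    have hsz : pos C' < size xs by apply: leq_trans h (find_size _ _).
    have [y yE] : exists y, index y xs = pos C'.
      case: xs hsz (uniq_listing xs_perm) => // x0 s hsz us.
      by exists (nth x0 (x0 :: s) (pos C')); rewrite index_uniq.
    have yC : lt (inr y) (inl C) by rewrite posE yE.
    have : lt (inr y) (inl C') by apply: tr yC _; rewrite hcc.
    by rewrite posE yE ltnn.
  rewrite -(edges_added_at (lt := lt)) // => x.
  rewrite leqNgt -posE; case h : (lt (inr x) (inl C)); first exact: asym.
  by have := tot (inl C) (inr x) isT; rewrite h orbF.
pose lt (a b : cla + var) := match a, b with
  | inl C, inl C' => before cs C C'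
  | inr x, inr x' => before xs x x'
  | inr x, inl C => index x xs < pos C
  | inl C, inr x => pos C <= index x xs
  end.
have lt_order : strict_total_order lt.
  split.
  - by case=> a; rewrite /= /before ltnn.
  - case=> b [] a [] c; rewrite /= /before; try lia.
    + by move=> ac bc; move: (posmono _ _ ac); lia.
    + by move=> ac bc; move: (posmono _ _ bc); lia.
    (* A variable lies between two clauses, so their positions differ strictly and the monotonicity
       of [pos] decides the order of the clauses. *)
    + move=> ac bc; case: (ltngtP (index a cs) (index c cs)) => // h.
      * by move: (posmono _ _ h); lia.
      * by move: ac bc; rewrite (inj_cs _ _ h); lia.
  - case=> a [] b; rewrite /= /before => ab; try lia.
    + have : index a cs != index b cs.
        by apply: contraNneq ab => /inj_cs ->.
      by lia.
    + have : index a xs != index b xs.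
        by apply: contraNneq ab => /inj_xs ->.
      by lia.
by exists lt; split; split=> // C; rewrite (edges_added_at (p := pos C)).
Qed.

Lemma insert_all_positions q todo ub ps :
  uniq todo -> insert_all E cs xs q todo ub = Some ps -> ub <= size xs ->
  exists pos : cla -> nat,
    [/\ forall C, C \in todo -> pos C <= ub,
        sorted (fun C C' => pos C' <= pos C) todo
      & forall C, C \in todo -> added_at C (pos C) <= q].
Proof.
elim: todo ub ps => [|C todo IH] ub ps; first by exists (fun=> 0); split.
rewrite [uniq _]/= => /andP [Cnin utodo] /= + leub.
have := highest_spec q C leub; case: highest => // p [pub hp _].
case hins : insert_all => [ps'|] //= _.
have [pos [h1 h2 h3]] := IH _ _ utodo hins (leq_trans pub leub).
have trans_pos (f : cla -> nat) : transitive (fun C C' => f C' <= f C).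
  by move=> ? ? ? h h'; apply: leq_trans h' h.
pose pos' C' := if C' == C then p else pos C'.
have posE C' : C' \in todo -> pos' C' = pos C'.
  by rewrite /pos'; case: eqVneq => // ->; rewrite (negbTE Cnin).
exists pos'; split=> [C'||C']; first 1 last.
- rewrite path_sortedE //; apply/andP; split.
    by apply/allP => C' C'in; rewrite posE // /pos' eqxx h1.
  rewrite (@eq_in_sorted _ [in todo] _ (fun C C' => pos C' <= pos C)) //.
  by move=> C1 C2 i1 i2; rewrite /= !posE.
- rewrite inE; case: eqVneq => [-> _|_ /= C'in]; first by rewrite /pos' eqxx.
  by rewrite posE // h3.
- rewrite inE; case: eqVneq => [-> _|_ /= C'in]; first by rewrite /pos' eqxx.
  by rewrite posE //; apply: leq_trans pub; apply: h1.
Qed.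

Definition succeeds (q : nat) : bool := isSome (greedy_round E cs xs q).

Lemma succeeds_mergeable q : succeeds q <-> mergeable E cs xs q.
Proof.
have ucs := uniq_listing cs_perm.
rewrite mergeable_positions /succeeds /greedy_round; split.
  case hins : insert_all => [ps|] // _.
  have [||pos [h1 h2 h3]] := insert_all_positions _ hins; rewrite ?rev_uniq //.
  have inr C : C \in rev cs by rewrite mem_rev mem_listing.
  exists pos; split=> [C|C C' CC'|C]; [exact: h1| |exact: h3].
  rewrite rev_sorted in h2.
  have tr : transitive (fun C C' => pos C <= pos C').
    by move=> ? ? ? h h'; apply: leq_trans h h'.
  by apply: (sorted_ltn_index tr h2); rewrite ?mem_listing.
case=> pos [h1 h2 h3]; apply: (@insert_all_some _ pos) => //.
rewrite rev_sorted; case cs_eq : {1}cs => [//|C0 s]; rewrite -cs_eq.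
apply/(sortedP C0) => i ilt; apply: h2; rewrite !index_uniq //; exact: ltnW ilt.
Qed.

(** Read off the characterisation by positions, where [q] occurs only as an upper bound; the greedy
    positions of the two rounds need not be compared. *)
Lemma succeeds_mono q q' : q <= q' -> succeeds q -> succeeds q'.
Proof.
move=> qq' /succeeds_mergeable /mergeable_positions [pos [h1 h2 h3]].
apply/succeeds_mergeable/mergeable_positions; exists pos; split=> // C.
exact: leq_trans (h3 C) qq'.
Qed.

(** All clauses can be put below all variables, since no clause adds more than all the variables.
    This makes the search for [q] terminate. *)
Lemma succeeds_max : succeeds (size xs).
Proof.
apply/succeeds_mergeable/mergeable_positions; exists (fun=> 0); split=> // C.
exact: added_at_max.
Qed.

Lemma greedy_fromP q k : greedy_from E cs xs q k <->
  [/\ q <= k, succeeds k & forall q', q <= q' < k -> ~~ succeeds q'].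
Proof.
rewrite /succeeds; split.
  elim=> {q k} [q h|q k h _ [h1 h2 h3]].
    by split=> // q'; lia.
  split=> // [|q' /andP []]; first lia.
  rewrite leq_eqVlt => /orP [/eqP <-|h4 h5]; first by rewrite h.
  by apply: h3; rewrite h4.
move=> [h1 h2 h3]; move: h1; have [d] := ubnP (k - q).
elim: d q h3 => // d IH q h3 hd; rewrite leq_eqVlt => /orP [/eqP ->|qk].
  exact: GreedyStop.
apply: GreedyNext.
  by have := h3 q; rewrite leqnn qk; case: greedy_round => // ? /(_ isT).
apply: IH; [move=> q' h|lia|lia]; apply: h3; lia.
Qed.

Lemma greedy_correct : exists k, greedy_outputs E cs xs k /\ min_mergeable E cs xs k.
Proof.
have ex : exists q, succeeds q by exists (size xs); exact: succeeds_max.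
exists (ex_minn ex); case: ex_minnP => k hk hmin; split.
  by apply/greedy_fromP; split=> // q' h; apply/negP => /hmin; lia.
by split=> [|k' /succeeds_mergeable /hmin]; first apply/succeeds_mergeable.
Qed.

End Merging.

(** * Counting added edges on ranks *)

(** Serves to sort the concatenated adjacency lists: [hS] compares entries of different blocks, [hT]
    entries of one block. *)
Lemma pairwise_allpairs (S T R : Type) (f : S -> T -> R) (rS : rel S)
    (rT : rel T) (r : rel R) (s : seq S) (t : seq T) :
  (forall a a' b b', rS a a' -> r (f a b) (f a' b')) ->
  (forall a b b', rT b b' -> r (f a b) (f a b')) ->
  pairwise rS s -> pairwise rT t -> pairwise r [seq f a b | a <- s, b <- t].
Proof.
move=> hS hT + tP; have hS' a a' b : rS a a' -> all (r (f a b)) [seq f a' b' | b' <- t].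
  by move=> aa'; rewrite all_map; elim: t {tP} => //= c t ->; rewrite hS.
elim: s => //= a s IH /andP [aP sP].
rewrite pairwise_cat IH // andbT pairwise_map; apply/andP; split; last first.
  by apply: sub_pairwise tP => b b'; apply: hT.
elim: s aP {IH sP} => [|a' s IH] /=; first by move=> _; apply/allrel0r.
case/andP=> aa' /IH h; rewrite allrel_catr h andbT.
by elim: {1}t => //= b t1; rewrite allrel_consl hS'.
Qed.

Lemma pairwise_before (T : eqType) (s : seq T) : uniq s -> pairwise (before s) s.
Proof.
move=> us; case: s us => [//|x0 s']; move: (x0 :: s') => s us.
apply/(pairwiseP x0) => i j; rewrite !inE => hi hj ij.
by rewrite /before !index_uniq.
Qed.

Lemma count_interval a b n : b <= n -> count (fun k => a <= k < b) (iota 0 n) = b - a.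
Proof.
elim: n b => [|n IH] b; first by case: b.
rewrite -addn1 iotaD count_cat /= add0n addn0 => bn.
case: (leqP b n) => h; first by rewrite IH //; lia.
have -> : count (fun k => a <= k < b) (iota 0 n) = count (fun k => a <= k < n) (iota 0 n).
  by apply: eq_in_count => k; rewrite mem_iota; lia.
by rewrite IH //; lia.
Qed.

(* D(p), with only the first [j] edges kept. *)
Definition covered (u : seq (nat * nat)) (n j p : nat) : nat :=
  count (fun y => (p <= y) && (y \in [seq e.2 | e <- take j u])) (iota 0 n).

(** The boundary, in a list sorted by clause rank, in front of the edges of clause [b]. One [j] may
    serve several [b]: the clauses between them are then isolated. *)
Definition cut (u : seq (nat * nat)) (j b : nat) : Prop :=
  j <= size u /\
  forall k, k < size u -> ((nth (0, 0) u k).1 < b) = (k < j).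

Section Ranks.

Variables (cla var : finType) (E : {set cla * var}).
Variables (cs : seq cla) (xs : seq var).
Hypotheses (cs_perm : perm_eq cs (enum cla)) (xs_perm : perm_eq xs (enum var)).

Definition ranks (e : cla * var) : nat * nat := (index e.1 cs, index e.2 xs).

Definition edge_ranks := [seq ranks e | e <- edges_by_clause E cs xs].

Lemma ranks_inj : injective ranks.
Proof.
move=> [C x] [C' x'] [] /(index_listing_inj cs_perm) -> h.
by rewrite (index_listing_inj xs_perm h).
Qed.

Lemma mem_edges_by_clause e : (e \in edges_by_clause E cs xs) = (e \in E).
Proof.
rewrite mem_filter andb_idr // => _; case: e => C x.
by apply/allpairsP; exists (C, x); rewrite !mem_listing.
Qed.

Lemma mem_edges_by_variable e : (e \in edges_by_variable E cs xs) = (e \in E).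
Proof.
rewrite mem_filter andb_idr // => _; case: e => C x.
by apply/allpairsP; exists (x, C); rewrite !mem_listing.
Qed.

Lemma edges_by_clause_uniq : uniq (edges_by_clause E cs xs).
Proof.
apply/filter_uniq/allpairs_uniq; rewrite ?(uniq_listing cs_perm) ?(uniq_listing xs_perm) //.
by move=> [? ?] [? ?] _ _ [-> ->].
Qed.

Lemma size_edge_ranks : size edge_ranks = #|E|.
Proof.
rewrite size_map -(eq_card mem_edges_by_clause); apply/esym/card_uniqP.
exact: edges_by_clause_uniq.
Qed.

Lemma size_edges_by_variable : size (edges_by_variable E cs xs) = #|E|.
Proof.
rewrite -(eq_card mem_edges_by_variable); apply/esym/card_uniqP.
apply/filter_uniq/allpairs_uniq; rewrite ?(uniq_listing cs_perm) ?(uniq_listing xs_perm) //.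
by move=> [? ?] [? ?] _ _ [-> ->].
Qed.

Lemma mem_edge_ranks C x : ((index C cs, index x xs) \in edge_ranks) = ((C, x) \in E).
Proof. by rewrite -mem_edges_by_clause -(mem_map ranks_inj). Qed.

Lemma edge_ranksP e :
  reflect (exists C x, (C, x) \in E /\ e = (index C cs, index x xs)) (e \in edge_ranks).
Proof.
apply: (iffP mapP) => [[[C x]]|[C [x [Ein ->]]]].
  by rewrite mem_edges_by_clause => Ein ->; exists C, x.
by exists (C, x); rewrite ?mem_edges_by_clause.
Qed.

Lemma edge_ranks_lex :
  pairwise (fun e e' => (e.1 < e'.1) || (e.1 == e'.1) && (e.2 < e'.2)) edge_ranks.
Proof.
rewrite pairwise_map; apply: pairwise_filter.
apply: (pairwise_allpairs (rS := before cs) (rT := before xs)).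
- by rewrite /before /= => ? ? ? ? ->.
- by move=> C x x'; rewrite /before /= eqxx orbC => ->.
- exact/pairwise_before/(uniq_listing cs_perm).
- exact/pairwise_before/(uniq_listing xs_perm).
Qed.

Definition var_ranks := [seq index e.2 xs | e <- edges_by_variable E cs xs].

Lemma var_ranks_sorted : pairwise leq var_ranks.
Proof.
rewrite pairwise_map; apply: pairwise_filter.
apply: (pairwise_allpairs (rS := before xs) (rT := before cs)).
- by rewrite /before /= => ? ? ? ? /ltnW.
- by move=> x C C' _ /=.
- exact/pairwise_before/(uniq_listing xs_perm).
- exact/pairwise_before/(uniq_listing cs_perm).
Qed.

Lemma mem_var_ranks : var_ranks =i [seq e.2 | e <- edge_ranks].
Proof.
move=> y; rewrite -map_comp; apply/mapP/mapP => -[e]; 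
  rewrite ?mem_edges_by_clause ?mem_edges_by_variable => eE ->;
  by exists e; rewrite ?mem_edges_by_clause ?mem_edges_by_variable.
Qed.

Lemma card_rank (P : pred nat) : #|[set x | P (index x xs)]| = count P (iota 0 (size xs)).
Proof.
have -> : iota 0 (size xs) = [seq index x xs | x <- xs].
  apply: (@eq_from_nth _ 0); first by rewrite size_map size_iota.
  move=> i; rewrite size_iota => ilt; rewrite nth_iota //.
  have x0 : var by case: (xs) ilt.
  by rewrite (nth_map x0) // index_uniq ?(uniq_listing xs_perm).
rewrite count_map (permP xs_perm) cardE enumT -size_filter; congr size.
by rewrite /enum_mem; apply: eq_filter => x; rewrite !inE.
Qed.

Lemma mem_take_edge_ranks j y : (y \in [seq e.2 | e <- take j edge_ranks]) <->
  exists2 k, k < minn j (size edge_ranks) & (nth (0, 0) edge_ranks k).2 = y.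
Proof.
split=> [/(nthP 0) [k]|[k klt <-]].
  rewrite size_map size_take_min => klt; rewrite (nth_map (0, 0)) ?size_take_min //.
  by rewrite nth_take; [move=> <-; exists k | lia].
apply/(nthP 0); exists k; rewrite ?size_map ?size_take_min //.
by rewrite (nth_map (0, 0)) ?size_take_min // nth_take //; lia.
Qed.

Lemma nth_edge_ranksP k : k < size edge_ranks ->
  exists C x, (C, x) \in E /\ nth (0, 0) edge_ranks k = (index C cs, index x xs).
Proof. by move=> klt; apply/edge_ranksP/mem_nth. Qed.

(** Ensures that the first edge of a clause leads to its first variable. *)
Lemma edge_ranks_slice k k' : k < k' < size edge_ranks ->
  (nth (0, 0) edge_ranks k).1 = (nth (0, 0) edge_ranks k').1 ->
  (nth (0, 0) edge_ranks k).2 < (nth (0, 0) edge_ranks k').2.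
Proof.
move=> /andP [kk' k'lt] eqA; have /(pairwiseP (0, 0)) lex := edge_ranks_lex.
have := lex k k'; rewrite !inE k'lt (ltn_trans kk' k'lt) kk' => /(_ isT isT isT).
by rewrite eqA ltnn eqxx.
Qed.

(** The edges of [C] occupy the indices from [st] to [j - 1], without repetition. *)
Lemma degree_cut C st j (b := index C cs) : cut edge_ranks st b -> cut edge_ranks j b.+1 ->
  #|[set x | (C, x) \in E]| = j - st.
Proof.
move=> [_ hst] [jle hj].
transitivity (count (fun e => e.1 == b) edge_ranks); last first.
  rewrite -[in LHS](mkseq_nth (0, 0) edge_ranks) count_map -(count_interval st jle).
  apply: eq_in_count => k; rewrite mem_iota /= => klt.
  by have := hst k klt; have := hj k klt; lia.
transitivity (size [seq e.2 | e <- edges_by_clause E cs xs & e.1 == C]); last first.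
  rewrite size_map size_filter count_map; apply: eq_count => e /=.
  by rewrite (inj_eq (index_listing_inj cs_perm)).
have /eq_card -> : [set x | (C, x) \in E] =i [seq e.2 | e <- edges_by_clause E cs xs & e.1 == C].
  move=> x; rewrite inE; apply/idP/mapP => [xE|[[C' x']]].
    by exists (C, x); rewrite // mem_filter eqxx mem_edges_by_clause.
  by rewrite mem_filter mem_edges_by_clause /= => /andP [/eqP -> ?] ->.
apply/card_uniqP; rewrite map_inj_in_uniq; first exact: filter_uniq edges_by_clause_uniq.
move=> [C1 x1] [C2 x2]; rewrite !mem_filter /= => /andP [/eqP -> _] /andP [/eqP -> _] ->.
by [].
Qed.

(** Adding the degree turns the count of non-neighbours into a count over all variables. The test
    [st < j] singles out isolated clauses, for which entry [st] is not an edge of [C]. *)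
Lemma added_at_covered C p st j (b := index C cs) :
  p <= size xs -> cut edge_ranks st b -> cut edge_ranks j b.+1 ->
  added_at E cs xs C p + (j - st) =
  (if st < j then p - (nth (0, 0) edge_ranks st).2 else 0) + covered edge_ranks (size xs) j p.
Proof.
move=> ple cst cj; rewrite -(degree_cut cst cj).
have [stle hst] := cst; have [jle hj] := cj.
pose cov y := (st < j) && ((nth (0, 0) edge_ranks st).2 <= y < p)
  || (p <= y) && (y \in [seq e.2 | e <- take j edge_ranks]).
have nbr x : (C, x) \in E -> exists2 k, st <= k < j & nth (0, 0) edge_ranks k = (b, index x xs).
  rewrite -mem_edge_ranks => /(nthP (0, 0)) [k klt kE]; exists k => //.
  by have := hst k klt; have := hj k klt; rewrite kE /=; lia.
have first_le k : st <= k < j -> (nth (0, 0) edge_ranks st).2 <= (nth (0, 0) edge_ranks k).2.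
  case/andP; rewrite leq_eqVlt => /orP [/eqP ->//|stk kj].
  apply/ltnW/edge_ranks_slice; first lia.
  have := hst k; have := hst st; have := hj k; have := hj st; lia.
have -> : (if st < j then p - (nth (0, 0) edge_ranks st).2 else 0) + covered edge_ranks (size xs) j p
    = count cov (iota 0 (size xs)).
  have -> : (if st < j then p - (nth (0, 0) edge_ranks st).2 else 0) =
      count (fun y => (st < j) && ((nth (0, 0) edge_ranks st).2 <= y < p)) (iota 0 (size xs)).
    case: ifP => _ /=; first by rewrite count_interval.
    by rewrite (eq_count (a2 := pred0)) ?count_pred0.
  rewrite /covered -count_predUI addnC (eq_count (a2 := pred0)) ?count_pred0 //.
  by move=> y /=; lia.
(* Neighbours of [C] all satisfy [cov] and account for the degree; for the others, the two disjuncts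
   of [cov] match the two conditions of EdgesAdded. *)
rewrite -card_rank -[RHS](cardsID [set x | (C, x) \in E]) addnC; congr (_ + _).
  apply: eq_card => x; rewrite !inE; apply/idP/andP => [xE|[]//]; split=> //.
  have [k kst kE] := nbr x xE; have := first_le k kst; rewrite kE /cov /= => h.
  case: (ltnP (index x xs) p) => hp; first by apply/orP; left; lia.
  apply/orP; right; rewrite /=; apply/mem_take_edge_ranks; exists k; rewrite ?kE //; lia.
apply: eq_card => x; rewrite !inE; case xE : ((C, x) \in E) => //=.
have xN x' : (C, x') \in E -> (index x xs == index x' xs) = false.
  move=> h; apply/eqP => /(index_listing_inj xs_perm) hx.
  by rewrite hx h in xE.
rewrite /cov; congr (_ || _).
  apply/existsP/andP => [[x' /and3P [x'E h1 h2]]|[stj h]].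
    have [k kst kE] := nbr x' x'E; have := first_le k kst; rewrite kE /= => h3.
    by split; lia.
  have [C' [x' [x'E stE]]] := nth_edge_ranksP (leq_trans stj jle).
  have CC' : index C' cs = b.
    have := hst st (leq_trans stj jle); have := hj st (leq_trans stj jle); rewrite stE /=; lia.
  exists x'; rewrite (index_listing_inj cs_perm CC') in x'E *.
  by rewrite x'E; have := xN x' x'E; move: h; rewrite stE /=; lia.
apply/existsP/andP => [[C' /and3P [C'E h1 h2]]|[h /mem_take_edge_ranks [k klt kE]]].
  split=> //; apply/mem_take_edge_ranks; move: C'E; rewrite -mem_edge_ranks => /(nthP (0, 0)) [k klt kE].
  exists k; rewrite ?kE //; have := hj k klt; rewrite kE /=; rewrite /b; lia.
have [|C' [x' [x'E uk]]] := @nth_edge_ranksP k; first lia.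
have xx' : x' = x by apply: (index_listing_inj xs_perm); move: kE; rewrite uk.
rewrite {x'}xx' in x'E uk; exists C'; rewrite x'E h andbT /=.
(* The first [j] edges include those of [C], but [x] is not a neighbour of [C], so the clause found
   has strictly smaller rank. *)
rewrite ltn_neqAle; have := hj k; rewrite uk /= ltnS => ->; last lia.
rewrite (_ : k < j) ?andbT; last lia.
by apply/eqP => /(index_listing_inj cs_perm) CC'; rewrite -CC' x'E in xE.
Qed.

End Ranks.

(** * Total correctness with time for the word RAM *)

Section RAM.

Variables (W M : nat).

Definition bounded (s : state) : Prop :=
  (forall r, reg s r <= M) /\ (forall a i, arr s a i <= M).

(* [weight e * M.+1] bounds every value met while evaluating e in a bounded state. *)
Fixpoint weight (e : expr) : nat :=
  match e with
  | Defs.Num n => n.+1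
  | Reg _ => 1
  | Cell _ e1 => (weight e1).+1
  | Half e1 => weight e1
  | Plus e1 e2 | Minus e1 e2 => weight e1 + weight e2
  end.

Lemma eval_weight s e : bounded s -> eval s e <= weight e * M.+1.
Proof.
move=> [hr ha]; elim: e => [n|r|a e IH|e1 IH1 e2 IH2|e1 IH1 e2 IH2|e IH] /=.
- nia.
- by have := hr r; lia.
- by have := ha a (eval s e); nia.
- nia.
- nia.
- lia.
Qed.

Lemma fits_weight s e : bounded s -> weight e * M.+1 < W -> fits W s e.
Proof.
move=> hs; have small e' : weight e' * M.+1 < W -> eval s e' < W.
  by apply: leq_ltn_trans; apply: eval_weight.
elim: e => [n|r|a e IH|e1 IH1 e2 IH2|e1 IH1 e2 IH2|e IH] hW;
  move: (small _ hW) => /= -> //=.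
- by apply: IH; move: hW => /=; nia.
- by rewrite IH1 ?IH2 //; move: hW => /=; nia.
- by rewrite IH1 ?IH2 //; move: hW => /=; nia.
- exact: IH.
Qed.

(** A total-correctness judgement whose postcondition also sees the elapsed time; boundedness is
    carried along implicitly, to exclude overflow. *)
Definition run (P : prog) (s : state) (Q : nat -> state -> Prop) : Prop :=
  bounded s -> exists t s', [/\ exec W P s t s', bounded s' & Q t s'].

Lemma run_skip s (Q : nat -> state -> Prop) : Q 1 s -> run Skip s Q.
Proof. by move=> h hs; exists 1, s; split=> //; constructor. Qed.

Lemma run_assign r e s (Q : nat -> state -> Prop) :
  weight e * M.+1 < W -> eval s e <= M ->
  Q (cost e).+1 (set_reg s r (eval s e)) -> run (Assign r e) s Q.
Proof.
move=> hW hM hQ hs; eexists; eexists; split; last exact: hQ.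
  by constructor; apply: fits_weight.
by have [hr ha] := hs; split=> //= r'; case: ifP.
Qed.

Lemma run_store a e1 e2 s (Q : nat -> state -> Prop) :
  weight e1 * M.+1 < W -> weight e2 * M.+1 < W -> eval s e2 <= M ->
  Q (cost e1 + cost e2).+1 (set_cell s a (eval s e1) (eval s e2)) ->
  run (Store a e1 e2) s Q.
Proof.
move=> hW1 hW2 hM hQ hs; eexists; eexists; split; last exact: hQ.
  by constructor; apply: fits_weight.
by have [hr ha] := hs; split=> //= a' i; case: ifP.
Qed.

Lemma run_seq P1 P2 s (Q : nat -> state -> Prop) :
  run P1 s (fun t1 s1 => run P2 s1 (fun t2 s2 => Q (t1 + t2) s2)) ->
  run (Seq P1 P2) s Q.
Proof.
move=> h hs; have [t1 [s1 [e1 b1 /(_ b1) [t2 [s2 [e2 b2 q]]]]]] := h hs.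
by exists (t1 + t2), s2; split=> //; apply: ExecSeq e1 e2.
Qed.

Lemma run_if e1 e2 P1 P2 s (Q : nat -> state -> Prop) :
  weight e1 * M.+1 < W -> weight e2 * M.+1 < W ->
  (eval s e1 <= eval s e2 ->
    run P1 s (fun t s' => Q ((cost e1 + cost e2).+1 + t) s')) ->
  (eval s e2 < eval s e1 ->
    run P2 s (fun t s' => Q ((cost e1 + cost e2).+1 + t) s')) ->
  run (IfLeq e1 e2 P1 P2) s Q.
Proof.
move=> hW1 hW2 h1 h2 hs.
suff [t [s' [e b q]]] : exists t s',
    [/\ exec W (if eval s e1 <= eval s e2 then P1 else P2) s t s', bounded s'
      & Q ((cost e1 + cost e2).+1 + t) s'].
  by exists ((cost e1 + cost e2).+1 + t), s'; split=> //;
     apply: ExecIf => //; apply: fits_weight.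
by case: leqP => h; [apply: h1|apply: h2].
Qed.

Lemma run_weaken P s (Q Q' : nat -> state -> Prop) :
  run P s Q -> (forall t s', Q t s' -> Q' t s') -> run P s Q'.
Proof.
by move=> h hQ hs; have [t [s' [e b q]]] := h hs; exists t, s'; split=> //; apply: hQ.
Qed.

(* The potential [phi] pays for the iterations. *)
Lemma run_while e1 e2 P (I : state -> Prop) (phi : state -> nat) s
    (Q : nat -> state -> Prop) :
  weight e1 * M.+1 < W -> weight e2 * M.+1 < W ->
  I s ->
  (forall s, I s -> eval s e1 <= eval s e2 ->
    run P s (fun t s' => I s' /\ (cost e1 + cost e2).+1 + t + phi s' <= phi s)) ->
  (forall t s', I s' -> eval s' e2 < eval s' e1 ->
    t + phi s' <= phi s + (cost e1 + cost e2).+1 -> Q t s') ->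
  run (WhileLeq e1 e2 P) s Q.
Proof.
(* Testing the guard already costs at least one step, so [phi] strictly decreases and also serves as
   the termination measure. *)
move=> hW1 hW2 + hP; have [d] := ubnP (phi s).
elim: d s Q => // d IH s Q hd hI hQ hs.
have [h|h] := leqP (eval s e1) (eval s e2); last first.
  exists (cost e1 + cost e2).+1, s; split=> //.
    by apply: ExecWhileStop => //; apply: fits_weight.
  by apply: hQ => //; rewrite addnC.
have [t1 [s1 [ex1 b1 [I1 p1]]]] := hP s hI h hs.
have [||t2 [s2 [ex2 b2 q2]]] := IH s1 (fun t2 s2 => Q ((cost e1 + cost e2).+1 + t1 + t2) s2) _ I1 _ b1.
- by lia.
- by move=> t s' Is' hs' ht; apply: hQ => //; lia.
exists ((cost e1 + cost e2).+1 + t1 + t2), s2; split=> //.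
by apply: ExecWhileStep ex1 ex2 => //; apply: fits_weight.
Qed.

End RAM.

(* Only the registers in [L] may have changed. *)
Definition keeps (L : seq nat) (s0 s : state) : Prop :=
  arr s = arr s0 /\ forall r, r \notin L -> reg s r = reg s0 r.

Lemma keeps_trans L L' s0 s1 s2 : {subset L' <= L} ->
  keeps L s0 s1 -> keeps L' s1 s2 -> keeps L s0 s2.
Proof.
move=> sub [a1 r1] [a2 r2]; split=> [|r rL]; first by rewrite a2.
by rewrite r2 ?r1 //; apply: contra rL; apply: sub.
Qed.

Lemma keeps_set L s0 s r x : r \in L -> keeps L s0 s -> keeps L s0 (set_reg s r x).
Proof.
move=> rL [a1 r1]; split=> // r' r'L /=; case: eqVneq => [eq_r|_]; last exact: r1.
by rewrite eq_r rL in r'L.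
Qed.

(** * One round of the greedy algorithm *)

Ltac small := by rewrite /=; lia.

(** * Variation of D(p) with the position and with the kept edges *)

Section Covered.

Variables (n : nat) (u : seq (nat * nat)).

Lemma covered0 p : covered u n 0 p = 0.
Proof.
rewrite /covered take0 (eq_count (a2 := pred0)) ?count_pred0 // => y.
by rewrite in_nil andbF.
Qed.

Lemma covered_top j : covered u n j n = 0.
Proof.
rewrite /covered (eq_in_count (a2 := pred0)) ?count_pred0 // => y.
by rewrite mem_iota /=; lia.
Qed.

Lemma covered_le j p : covered u n j p <= n.
Proof. by apply: leq_trans (count_size _ _) _; rewrite size_iota. Qed.

Lemma covered_anti j p p' : p' <= p -> covered u n j p <= covered u n j p'.
Proof.
by move=> pp'; apply: sub_count => y /andP [py ->]; rewrite (leq_trans pp' py).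
Qed.

Lemma count_mem_range (P : pred nat) p d :
  p < d -> count (fun y => (p <= y) && P y) (iota 0 d)
           = P p + count (fun y => (p < y) && P y) (iota 0 d).
Proof.
move=> pd; have -> : d = p + (d - p.+1).+1 by lia.
rewrite iotaD !count_cat /= ltnn leqnn /= add0n.
rewrite (@eq_in_count _ _ pred0) ?count_pred0; last by move=> y; rewrite mem_iota /=; lia.
rewrite (@eq_in_count _ (fun y => (p < y) && P y) pred0 (iota 0 p)) ?count_pred0;
  last by move=> y; rewrite mem_iota /=; lia.
rewrite !add0n; congr (_ + _); apply: eq_in_count => y; rewrite mem_iota /=; lia.
Qed.

Lemma covered_step j p : p < n ->
  covered u n j p = (p \in [seq e.2 | e <- take j u]) + covered u n j p.+1.
Proof. exact: count_mem_range. Qed.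

Lemma covered_flat j p p' : p' <= p <= n ->
  (forall y, p' <= y < p -> y \notin [seq e.2 | e <- u]) ->
  covered u n j p' = covered u n j p.
Proof.
move=> /andP [p'p pn] iso; apply: eq_in_count => y; rewrite mem_iota /= => yn.
case yin: (y \in _); rewrite ?andbF // !andbT.
have yu : y \in [seq e.2 | e <- u].
  by case/mapP: yin => e /mem_take ein ->; apply/mapP; exists e.
by case: (leqP p y) => h; [lia|apply/negbTE/negP => h2; have := iso y; rewrite h h2 yu => /(_ isT)].
Qed.

(** Edge [j] brings in a new variable exactly when it is the first edge of that variable; the index
    is never above [j], so [j <= index] says this. *)
Lemma covered_edge j p : j < size u -> (nth (0, 0) u j).2 < n ->
  covered u n j.+1 p = covered u n j p +
   ((p <= (nth (0, 0) u j).2) && (j <= index (nth (0, 0) u j).2 [seq e.2 | e <- u])).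
Proof.
move=> ju; set x := (nth (0, 0) u j).2 => xn.
have xin : x \in [seq e.2 | e <- u] by apply/map_f/mem_nth.
set b := _ && _; have bE : b = (p <= x) && (x \notin [seq e.2 | e <- take j u]).
  by rewrite /b [j <= _]leqNgt -in_take // map_take.
have <- : count (fun y => (y == x) && b) (iota 0 n) = b.
  case: (b); last by rewrite (eq_count (a2 := pred0)) ?count_pred0 // => y; rewrite andbF.
  rewrite (eq_count (a2 := pred1 x)) ?count_uniq_mem ?iota_uniq ?mem_iota ?xn //.
  by move=> y; rewrite andbT.
rewrite -count_predUI [X in _ + X](eq_count (a2 := pred0)) ?count_pred0 ?addn0; last first.
  by move=> y /=; case: eqVneq => [->|]; rewrite ?andbF // bE; case: (_ \in _); rewrite ?andbF.
apply: eq_count => y /=; rewrite (take_nth (0, 0)) // map_rcons mem_rcons inE -/x.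
case: eqVneq => [->|_] /=; last by rewrite orbF.
by rewrite andbT bE; case: (x \in _); rewrite ?andbT ?andbF ?orbF ?orbT.
Qed.


End Covered.

(* Registers: 1 and 2 hold the numbers of variables and edges, 3 q, 4 the position
   p, 5 D(p), 6 the number of edges not yet discarded, 7 the number of entries of
   array 3 not yet passed, 8 the last clause treated that has an edge, 9 the
   success flag, 10 to 12 the current clause, its first edge and first variable,
   13 and 14 the bounds of the search for k, 17 q + deg. Arrays 4 and 5 hold the
   first edge of each variable and of each clause that has one.

   Zeroing registers 4, 5 and 6 makes every enclosing loop of the round stop. *)
Definition fail_code : prog :=
  Seq (Assign 9 (Defs.Num 0)) (Seq (Assign 5 (Defs.Num 0))
    (Seq (Assign 4 (Defs.Num 0)) (Assign 6 (Defs.Num 0)))).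

(** Register 16 receives the next entry x of array 3. The cases are: no position can help; x is not
    below the position and is merely passed; the threshold is reached above x, by subtracting the
    excess; the position drops to x, and D grows if the first edge of x is kept. *)
Definition lower_step : prog :=
  IfLeq (Reg 4) (Reg 12) fail_code
  (Seq (Assign 16 (Cell 3 (Minus (Reg 7) (Defs.Num 1))))
  (IfLeq (Reg 4) (Reg 16) (Assign 7 (Minus (Reg 7) (Defs.Num 1)))
  (IfLeq (Plus (Minus (Reg 4) (Reg 12)) (Reg 5))
         (Plus (Reg 17) (Minus (Minus (Reg 4) (Defs.Num 1)) (Reg 16)))
    (Assign 4 (Minus (Reg 4)
       (Minus (Plus (Minus (Reg 4) (Reg 12)) (Reg 5)) (Reg 17))))
    (Seq (Assign 4 (Reg 16))
    (Seq (Assign 7 (Minus (Reg 7) (Defs.Num 1)))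
    (IfLeq (Plus (Cell 4 (Reg 16)) (Defs.Num 1)) (Reg 6)
       (Assign 5 (Plus (Reg 5) (Defs.Num 1))) Skip)))))).

Definition lower_code : prog :=
  WhileLeq (Plus (Reg 17) (Defs.Num 1)) (Plus (Minus (Reg 4) (Reg 12)) (Reg 5))
    lower_step.

(** Discards the edges of the clause from the last one on. D drops only for a variable at or above
    the position whose first edge is the discarded one, since otherwise an earlier edge still covers
    it. *)
Definition uncover_code : prog :=
  WhileLeq (Plus (Reg 11) (Defs.Num 1)) (Reg 6)
  (Seq (Assign 6 (Minus (Reg 6) (Defs.Num 1)))
  (IfLeq (Reg 4) (Cell 1 (Reg 6))
    (IfLeq (Reg 6) (Cell 4 (Cell 1 (Reg 6)))
       (Assign 5 (Minus (Reg 5) (Defs.Num 1))) Skip)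
    Skip)).

(** The last kept edge reveals the next clause that has an edge. If its rank is not immediately
    below register 8, isolated clauses lie between, and they all fit iff D is at most [q]. *)
Definition clause_code : prog :=
  Seq (Assign 10 (Cell 0 (Minus (Reg 6) (Defs.Num 1))))
  (Seq (Assign 11 (Cell 5 (Reg 10)))
  (Seq (Assign 12 (Cell 1 (Reg 11)))
  (Seq (Assign 17 (Plus (Reg 3) (Minus (Reg 6) (Reg 11))))
  (Seq (IfLeq (Plus (Reg 10) (Defs.Num 2)) (Reg 8)
         (IfLeq (Plus (Reg 3) (Defs.Num 1)) (Reg 5) fail_code Skip) Skip)
  (Seq lower_code (Seq uncover_code (Assign 8 (Reg 10)))))))).

(** Register 8 starts at the number of clauses, so isolated clauses at the top are handled like any
    other gap. *)
Definition round_code : prog :=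
  Seq (Assign 4 (Reg 1)) (Seq (Assign 5 (Defs.Num 0)) (Seq (Assign 6 (Reg 2))
  (Seq (Assign 7 (Reg 2)) (Seq (Assign 8 (Reg 0)) (Seq (Assign 9 (Defs.Num 1))
  (WhileLeq (Defs.Num 1) (Reg 6) clause_code)))))).

Definition loaded (u : seq (nat * nat)) (v : seq nat) (a : nat -> nat -> nat) : Prop :=
  [/\ forall j, a 0 j = (nth (0, 0) u j).1,
      forall j, a 1 j = (nth (0, 0) u j).2,
      forall g, a 3 g = nth 0 v g,
      {in [seq e.2 | e <- u], forall y, a 4 y = index y [seq e.2 | e <- u]}
    & {in [seq e.1 | e <- u], forall i, a 5 i = index i [seq e.1 | e <- u]}].

(** * Invariants and cost of one round, on ranks *)

Section Sweep.

Variables (m n q : nat) (u : seq (nat * nat)) (v : seq nat).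
(** [added b p] stands for EdgesAdded of the clause of rank [b] at position [p], and [ins b p] for
    the success of inserting the [b] lowest clauses at positions up to [p]. *)
Variables (added : nat -> nat -> nat) (ins : nat -> nat -> bool).

Hypotheses
  (u_lt : forall k, k < size u -> (nth (0, 0) u k).1 < m /\ (nth (0, 0) u k).2 < n)
  (u_sorted : forall k k', k <= k' < size u -> (nth (0, 0) u k).1 <= (nth (0, 0) u k').1)
  (ins0 : forall p, ins 0 p)
  (ins_in : forall b p, b < m -> p <= n -> added b p <= q -> ins b.+1 p = ins b p)
  (ins_out : forall b p, b < m -> p <= n -> q < added b p ->
     ins b.+1 p = (0 < p) && ins b.+1 p.-1)
  (added_cut : forall b p st j, b < m -> p <= n -> cut u st b -> cut u j b.+1 ->
     added b p + (j - st) =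
     (if st < j then p - (nth (0, 0) u st).2 else 0) + covered u n j p).

Lemma cut_index k (i := (nth (0, 0) u k).1) : k < size u ->
  cut u (index i [seq e.1 | e <- u]) i.
Proof.
move=> ku; have iin : i \in [seq e.1 | e <- u] by apply/map_f/mem_nth.
set st := index _ _; have stu : st < size u by rewrite -(size_map fst) index_mem.
have Ast : (nth (0, 0) u st).1 = i by rewrite -(nth_map (0, 0) 0) // nth_index.
split=> [|k' k'u]; first exact: ltnW.
apply/idP/idP => [h|k'st].
  by rewrite ltnNge; apply/negP => h'; have := @u_sorted st k'; lia.
have := before_find 0 k'st; rewrite (nth_map (0, 0)) //= => /negbT.
by have := @u_sorted k' st; lia.
Qed.

(** The last kept edge belongs to the highest clause below [b] that has an edge; hence one cut
    serves both [b] and [i.+1]. *)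
Lemma cut_last j b (i := (nth (0, 0) u j.-1).1) : 0 < j -> cut u j b ->
  [/\ i < b, cut u j i.+1 & index i [seq e.1 | e <- u] < j].
Proof.
move=> j0 [ju cutj]; have ib : i < b by rewrite cutj //; lia.
have ju' : j.-1 < size u by lia.
split=> //; first split=> // k ku; last first.
  by have [_ /(_ _ ju')] := cut_index ju'; rewrite -/i; lia.
have := cutj k ku; have := @u_sorted k j.-1; have := @u_sorted j.-1 k; rewrite -/i; lia.
Qed.

Lemma cut_mid j b b' c : cut u j b -> cut u j b' -> b' <= c <= b -> cut u j c.
Proof.
move=> [ju h] [_ h'] hc; split=> // k ku; have := h k ku; have := h' k ku; lia.
Qed.

(** The clauses of ranks from [b'] to [b - 1] are isolated, so each adds D(p) edges at [p]. Moving
    down never decreases D, so they all go to [p] or none of them fits. *)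
Lemma ins_gap j b b' p : cut u j b -> cut u j b' -> b' <= b <= m -> p <= n ->
  ins b p = ((b' < b) ==> (covered u n j p <= q)) && ins b' p.
Proof.
move=> cb cb' + pn; move: cb; elim: b => [|b IH] cb hb.
  by have -> : b' = 0 by lia.
have [->|b'b] := eqVneq b' b.+1; first by rewrite ltnn.
have cmid : cut u j b by apply: cut_mid cb cb' _; lia.
have addedE p' : p' <= n -> added b p' = covered u n j p'.
  by move=> h; have := added_cut _ h cmid cb; rewrite ltnn subnn addn0 => -> //; lia.
have -> : b' < b.+1 by lia.
case: leqP => /= hq; last first.
  elim: p {IH} pn hq => [|p IHp] pn hq; rewrite ins_out ?addedE //; try lia.
  by rewrite /= IHp //; [lia|apply: leq_trans hq _; exact: covered_anti].
by rewrite ins_in ?addedE ?IH ?hq ?implybT //; lia.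
Qed.

Lemma ins_skip b p p' : b < m -> p' <= p <= n ->
  (forall y, p' < y <= p -> q < added b y) -> ins b.+1 p = ins b.+1 p'.
Proof.
move=> bm; elim: p => [|p IH] hp h; first by have -> : p' = 0 by lia.
have [->//|pp'] := eqVneq p' p.+1.
by rewrite ins_out ?h ?IH //; try lia; move=> y hy; apply: h; lia.
Qed.

Lemma ins_fail b p : b < m -> p <= n ->
  (forall y, y <= p -> q < added b y) -> ins b.+1 p = false.
Proof.
move=> bm pn h; rewrite (@ins_skip _ p 0) //; last by move=> y /andP [_]; exact: h.
by rewrite ins_out ?h.
Qed.

Variables (W M : nat).
Hypotheses (M_large : m + n + n + size u + 3 <= M) (W_large : 40 * M.+1 < W)
  (q_small : q <= n + n + 1) (v_sorted : forall g g', g <= g' < size v -> nth 0 v g <= nth 0 v g')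
  (v_mem : v =i [seq e.2 | e <- u]) (v_size : size v = size u).

Definition failed (T : bool) (s : state) : Prop :=
  [/\ reg s 9 = 0, reg s 5 = 0, reg s 4 = 0, reg s 6 = 0 & T = false].

(** [T] is the outcome of the whole round, fixed throughout: the invariant says that the remaining
    subproblem has the same outcome. Entries of [v] below the position must not have been passed
    yet. *)
Definition placing (b : nat) (T : bool) (s : state) : Prop :=
  [/\ reg s 9 = 1, reg s 4 <= n, reg s 5 = covered u n (reg s 6) (reg s 4),
      reg s 7 <= size v /\ (forall k, k < size v -> nth 0 v k < reg s 4 -> k < reg s 7)
    & ins b (reg s 4) = T].

Lemma run_fail T s (Q : nat -> state -> Prop) : T = false ->
  (forall s', keeps [:: 4; 5; 6; 9] s s' -> failed T s' -> reg s' 7 = reg s 7 -> Q 8 s') ->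
  run W M fail_code s Q.
Proof.
move=> hT hQ.
apply: run_seq; apply: run_assign => //=; first lia.
apply: run_seq; apply: run_assign => //=; first lia.
apply: run_seq; apply: run_assign => //=; first lia.
apply: run_assign => //=; first lia.
apply: hQ => //; do ?apply: keeps_set => //.
Qed.

Lemma run_lower s0 i j st T : loaded u v (arr s0) -> i < m -> st < j ->
  cut u st i -> cut u j i.+1 -> reg s0 12 = (nth (0, 0) u st).2 ->
  reg s0 17 = q + (j - st) ->
  failed T s0 \/ (placing i.+1 T s0 /\ reg s0 6 = j) ->
  run W M lower_code s0 (fun t s =>
    [/\ keeps [:: 4; 5; 6; 7; 9; 16] s0 s,
        failed T s \/ (placing i T s /\ reg s 6 = j)
      & t + 60 * reg s 7 <= 60 * reg s0 7 + 100]).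
Proof.
move=> [_ _ a3 a4 _] im stj cst cj r12 r17 start.
set f := (nth _ _ _).2 in r12.
have addedE p : p <= n -> added i p + (j - st) = (p - f) + covered u n j p.
  by move=> pn; rewrite (added_cut im pn cst cj) stj.
have stu : st < size u by have [] := cj; lia.
have fn : f < n by have [] := u_lt stu.
have guard s : keeps [:: 4; 5; 6; 7; 9; 16] s0 s -> 
  eval s (Plus (Reg 17) (Defs.Num 1)) = q + (j - st) + 1 /\
  eval s (Plus (Minus (Reg 4) (Reg 12)) (Reg 5)) = reg s 4 - f + reg s 5.
  by move=> [_ r]; rewrite /= (r 17) // (r 12) // r17 r12.
pose I s := keeps [:: 4; 5; 6; 7; 9; 16] s0 s /\ 
  (failed T s \/ (placing i.+1 T s /\ reg s 6 = j)).
(* Each iteration passes an entry of array 3, except the last one, which fails or lands on the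
   threshold; the summand for the guard pays for that one. *)
pose phi s := 60 * (reg s 7 + (q + (j - st) < reg s 4 - f + reg s 5)).
apply: (run_while (I := I) (phi := phi)); [by rewrite /=; lia|by rewrite /=; lia|by rewrite /I; split| |].
- move=> s [ks inv]; have [-> ->] := guard s ks => hguard.
  have {inv} : placing i.+1 T s /\ reg s 6 = j by case: inv => [[? h1 h2 ? ?]|//]; lia.
  case=> [[r9 pn D [gv pend] ST] r6].
  have [as0 rs] := ks; have r12s : reg s 12 = f by rewrite rs.
  have r17s : reg s 17 = q + (j - st) by rewrite rs.
  have phi_s : phi s = 60 * (reg s 7 + 1) by rewrite /phi; move: hguard; lia.
  have D_n : reg s 5 <= n by rewrite D; apply: covered_le.
  have hq : q < added i (reg s 4) by have := addedE _ pn; rewrite r6 in D; lia.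
  apply: run_if; rewrite /= ?r12s; try lia.
    (* At or below [f] only D remains in the count, and D does not decrease downwards, so every
       lower position is inadmissible too. *)
    move=> pf; apply: (run_fail (T := T)).
      rewrite -ST; apply: ins_fail => // y yp.
      have := addedE y (leq_trans yp pn); have := addedE _ pn; have := covered_anti n u j yp; lia.
    move=> s' k' F r7; rewrite phi_s /phi; split; first split=> //; last first.
      by case: F => h1 -> -> h3 _; lia.
      by left.
    by apply: keeps_trans ks k' => z; rewrite !inE; lia.
  (* The first variable of the clause is itself an entry not yet passed, so register 7 is positive
     and the next entry is at least [f]. *)
  move=> fp; have fin : f \in v by rewrite v_mem; apply/map_f/mem_nth.
  have [k kv kf] := nthP 0 fin.
  have kg : k < reg s 7 by apply: pend; rewrite // kf.
  have ltv g : g < size v -> nth 0 v g < n.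
    move=> gsz; have : nth 0 v g \in v by apply: mem_nth.
    by rewrite v_mem => /(nthP 0) [k']; rewrite size_map => k'u <-; rewrite (nth_map (0, 0)) //;
      have [] := u_lt k'u.
  have gv' : reg s 7 - 1 < size v by lia.
  set x := nth 0 v (reg s 7 - 1); have xn : x < n by apply: ltv.
  have fx : f <= x by rewrite -kf; apply: v_sorted; lia.
  apply: run_seq; apply: run_assign; rewrite /= ?as0 ?a3 -/x; try lia.
  apply: run_if; [small|small| |]; rewrite /= ?as0 ?a3 -/x => px.
    apply: run_assign => //=; try lia.
    split; first split.
    - by do ?apply: keeps_set => //.
    - right; split=> //; split=> //=; split=> [|k' k'v k'p]; first lia.
      have [k'E|] := eqVneq k' (reg s 7 - 1); first by move: k'p; rewrite k'E -/x; lia.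
      by have := pend _ k'v k'p; lia.
    - by rewrite phi_s /phi /=; lia.
  have iso y : x < y < reg s 4 -> y \notin [seq e.2 | e <- u].
    move=> /andP [xy yp]; rewrite -v_mem; apply/negP => /(nthP 0) [k' k'v k'y].
    have : k' < reg s 7 by apply: pend; rewrite ?k'y.
    move=> k'g; have := @v_sorted k' (reg s 7 - 1); rewrite k'y -/x; lia.
  have flat y : x < y <= reg s 4 -> covered u n j y = reg s 5.
    move=> /andP [xy yp]; rewrite D r6; apply: covered_flat; first lia.
    by move=> z hz; apply: iso; lia.
  apply: run_if; [small|small| |]; rewrite /= ?r12s ?r17s => hr.
    apply: run_assign; rewrite /= ?r12s ?r17s; try lia.
    (* Above [x] the value of D is constant, so each unit of descent lowers the count by one and
       [p'] meets the threshold exactly. *)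
    set p' := _ - _; have p'E : p' - f + reg s 5 = q + (j - st) by lia.
    split; first split.
    - by do ?apply: keeps_set => //.
    - right; split=> //; split=> //=; first lia.
      + by rewrite r6 flat //; lia.
      + by split=> // k' k'v h; apply: pend => //; lia.
      + rewrite -ST; apply/esym/ins_skip => //; first lia.
        move=> y hy; have := addedE y; rewrite flat; lia.
    - by rewrite phi_s /phi /= p'E; lia.
  apply: run_seq; apply: run_assign; rewrite /= ?as0 ?a3 -/x; try lia.
  apply: run_seq; apply: run_assign; rewrite /= ?as0 ?a3 -/x; try lia.
  have xu : x \in [seq e.2 | e <- u] by rewrite -v_mem; apply: mem_nth.
  have inx : (index x [seq e.2 | e <- u] + 1 <= reg s 6) = (x \in [seq e.2 | e <- take j u]).
    by rewrite addn1 r6 -in_take // map_take.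
  have Sx : ins i.+1 x = T.
    rewrite -ST; apply/esym/ins_skip => //; first lia.
    by move=> y hy; have := addedE y; rewrite flat; lia.
  (* Only entries strictly below [x] must remain: further copies of [x] are passed later without
     moving. *)
  have pendx k' : k' < size v -> nth 0 v k' < x -> k' < reg s 7 - 1.
    move=> k'v k'x; have [k'E|] := eqVneq k' (reg s 7 - 1); first by rewrite /x -k'E in k'x; lia.
    by have := pend k' k'v (ltn_trans k'x px); lia.
  have cx : covered u n j x = (x \in [seq e.2 | e <- take j u]) + reg s 5.
    by rewrite covered_step // flat //; lia.
  apply: run_if; [small|small| |]; rewrite /= ?as0 ?a4 // ?inx => hx.
    apply: run_assign; [small|small|].
    split; first split.
    - by do ?apply: keeps_set => //.
    - right; split=> //; split=> //=; first lia.
      + by rewrite r6 cx hx addnC.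
      + by split=> //; lia.
    - by rewrite phi_s /phi /=; lia.
  apply: run_skip; split; first split.
  - by do ?apply: keeps_set => //.
  - right; split=> //; split=> //=; first lia.
    + by rewrite r6 cx -inx leqNgt hx.
    + by split=> //; lia.
  - by rewrite phi_s /phi /=; lia.
move=> t s [ks inv] ; have [-> ->] := guard s ks => hguard ht; split=> //; last first.
  by move: ht; rewrite /phi /=; lia.
case: inv => [?|[[r9 pn D pend ST] r6]]; first by left.
right; split=> //; split=> //; rewrite -ST ins_in //.
by have := addedE _ pn; rewrite r6 in D; lia.
Qed.

Lemma run_uncover s0 i j st T : loaded u v (arr s0) -> st <= j <= size u ->
  reg s0 11 = st ->
  failed T s0 \/ (placing i T s0 /\ reg s0 6 = j) ->
  run W M uncover_code s0 (fun t s =>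
    [/\ keeps [:: 5; 6] s0 s, failed T s \/ (placing i T s /\ reg s 6 = st)
      & t + 60 * reg s 6 <= 60 * reg s0 6 + 20]).
Proof.
move=> [_ a1 _ a4 _] /andP [stj ju] r11 start.
pose I s := keeps [:: 5; 6] s0 s /\
  (failed T s \/ (placing i T s /\ st <= reg s 6 <= j)).
apply: (run_while (I := I) (phi := fun s => 60 * reg s 6)) => //.
- small.
- small.
- rewrite /I; split=> //; case: start => [?|[? r6]]; [by left|right].
  by rewrite r6 leqnn stj.
- move=> s [ks inv] /=; have [as0 rs] := ks; rewrite (rs 11) // r11 => guard.
  have {inv} [[r9 pn D pend ST] hj] : placing i T s /\ st <= reg s 6 <= j.
    by case: inv => [[? h1 h2 ? ?]|//]; lia.
  have ku : reg s 6 - 1 < size u by lia.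
  have Ck := covered_edge (reg s 4) ku (proj2 (u_lt ku)).
  (* The old D is the new one plus the contribution of the discarded edge, so subtracting that
     contribution is exact. *)
  rewrite -[(reg s 6 - 1).+1]addn1 subnK in Ck; last by lia.
  set x := (nth _ _ _).2 in Ck; have [_ xn] := u_lt ku; rewrite -/x in xn.
  have xu : x \in [seq e.2 | e <- u] by apply/map_f/mem_nth.
  have D_n : reg s 5 <= n by rewrite D; apply: covered_le.
  rewrite Ck in D.
  apply: run_seq; apply: run_assign; [small|small|].
  apply: run_if; [small|small| |]; rewrite /= ?as0 ?a1 -/x => px; last first.
    apply: run_skip; split; [split|small].
      by do ?apply: keeps_set => //.
    right; split; last small.
    by split=> //=; rewrite D leqNgt px addn0.
  apply: run_if; [small|small| |]; rewrite /= ?as0 ?a1 -/x ?a4 // => hx.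
    apply: run_assign; [small|small|]; split; [split|by rewrite /=; lia].
      by do ?apply: keeps_set => //.
    right; split; last small.
    by split=> //=; rewrite D px hx addnK.
  apply: run_skip; split; [split|small].
    by do ?apply: keeps_set => //.
  right; split; last small.
  by split=> //=; rewrite D leqNgt [in X in _ && X]leqNgt hx andbF addn0.
move=> t s [ks inv] /=; have [as0 rs] := ks; rewrite (rs 11) // r11 => guard ht.
split=> //; last lia.
by case: inv => [?|[? h]]; [left|right; split=> //; lia].
Qed.

Definition sweeping (T : bool) (s : state) : Prop :=
  failed T s \/ [/\ placing (reg s 8) T s, cut u (reg s 6) (reg s 8) & reg s 8 <= m].

Definition round_regs := [:: 4; 5; 6; 7; 8; 9; 10; 11; 12; 16; 17].

Lemma run_clause s0 T : loaded u v (arr s0) -> reg s0 3 = q -> sweeping T s0 ->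
  0 < reg s0 6 ->
  run W M clause_code s0 (fun t s =>
    [/\ keeps round_regs s0 s, sweeping T s
      & t + 400 * reg s 6 + 60 * reg s 7 + 3 <= 400 * reg s0 6 + 60 * reg s0 7]).
Proof.
move=> ld r3 inv jpos; have [a0 a1 a3 a4 a5] := ld.
have {inv} [[r9 pn D pend ST] cb bm] : [/\ placing (reg s0 8) T s0,
    cut u (reg s0 6) (reg s0 8) & reg s0 8 <= m].
  by case: inv => [[? ? ? ? ?]|//]; lia.
set j := reg s0 6 in jpos D cb *; set b := reg s0 8 in ST cb bm.
have [] := cut_last jpos cb; set i := (nth _ _ _).1 => ib ci stj.
set st := index _ _ in stj.
have ju : j <= size u by have [] := cb.
have ju1 : j.-1 < size u by lia.
have iu : i \in [seq e.1 | e <- u] by apply/map_f/mem_nth.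
have cst : cut u st i by apply: cut_index; lia.
have stu : st < size u by lia.
have [_ fn] := u_lt stu; set f := (nth _ _ _).2 in fn.
have D_n : reg s0 5 <= n by rewrite D; apply: covered_le.
have gap := ins_gap cb ci (_ : i.+1 <= b <= m) pn.
rewrite {}gap ?ib // in ST.
apply: run_seq; apply: run_assign; [small|by rewrite /= a0 subn1 -/i; lia|].
apply: run_seq; apply: run_assign; [small|by rewrite /= a0 subn1 a5 -/i -/st //; lia|].
apply: run_seq; apply: run_assign; [small|by rewrite /= a0 a1 subn1 a5 -/i -/st //; lia|].
apply: run_seq; apply: run_assign; [small|by rewrite /= a0 subn1 a5 -/i -/st //; lia|].
rewrite /= a0 a1 subn1 -/j -/i a5 // -/st -/f r3.
set s1 := set_reg _ 17 _.
have k1 : keeps round_regs s0 s1 by do ?apply: keeps_set => //.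
apply: run_seq.
apply: (run_weaken (Q := fun t s => [/\ keeps [:: 4; 5; 6; 9] s1 s,
   failed T s \/ (placing i.+1 T s /\ reg s 6 = j), reg s 7 = reg s1 7 & t <= 50])).
  apply: run_if; [small|small| |] => /= hb; last first.
    apply: run_skip; split=> //; right; split=> //; split=> //.
    by move: ST; rewrite (_ : i.+1 < b = false) //; lia.
  apply: run_if; [small|small| |] => /= hD; rewrite r3 -/j in hD.
    apply: (run_fail (T := T)).
      have bq : reg s0 5 <= q = false by rewrite leqNgt -addn1 hD.
      have ib' : i.+1 < b by rewrite -addn2.
      by rewrite -ST -D ib' bq.
    by move=> s' k' F r7; split=> //; left.
  apply: run_skip; split=> //; right; split=> //; split=> //.
  by move: ST; rewrite -D (_ : reg s0 5 <= q) ?implybT // -ltnS -(addn1 q).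
move=> t1 s2 [k2 inv2 r72 t1le]; have [a2 r2] := k2.
have im : i < m by lia.
apply: run_seq; apply: run_weaken.
  apply: (run_lower (T := T) _ im stj cst ci _ _ inv2); first by rewrite a2.
    by rewrite r2.
  by rewrite r2.
move=> t2 s3 [k3 inv3 t2le]; have [ar3 r3'] := k3.
apply: run_seq; apply: run_weaken.
  apply: (run_uncover (st := st) _ _ _ inv3); first by rewrite ar3 a2.
    by rewrite (ltnW stj) ju.
  by rewrite r3' // r2.
move=> t3 s4 [k4 inv4 t3le]; have [ar4 r4'] := k4.
have r10 : reg s4 10 = i by rewrite r4' // r3' // r2.
apply: run_assign; [small|by rewrite /= r10; lia|].
have r7s : reg s4 7 = reg s3 7 by rewrite r4'.
have r71 : reg s1 7 = reg s0 7 by [].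
split.
- apply: keeps_set => //.
  apply: (keeps_trans (L' := [:: 5; 6])) k4; first by move=> z; rewrite !inE; lia.
  apply: (keeps_trans (L' := [:: 4; 5; 6; 7; 9; 16])) k3; first by move=> z; rewrite !inE; lia.
  by apply: (keeps_trans (L' := [:: 4; 5; 6; 9])) k2 => // z; rewrite !inE; lia.
- case: inv4 => [[? ? ? ? ?]|[P4 r6]]; [by left|right]; rewrite /= r10.
  by split=> //=; [rewrite r6|exact: ltnW].
- rewrite /=.
  (* At least one edge is discarded, as [st < j]; its 400 units pay for the constant overhead of the
     clause. *)
  have r63 : reg s3 6 <= j by case: inv3 => [[? ? ? -> ?]|[_ ->]].
  have r64 : reg s4 6 <= st by case: inv4 => [[? ? ? -> ?]|[_ ->]].
  lia.
Qed.

Lemma run_round s0 : loaded u v (arr s0) -> reg s0 0 = m -> reg s0 1 = n ->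
  reg s0 2 = size u -> reg s0 3 = q ->
  run W M round_code s0 (fun t s =>
    [/\ keeps round_regs s0 s, reg s 9 = ins m n & t <= 800 * (size u).+1]).
Proof.
move=> ld r0 r1 r2 r3.
do 6![apply: run_seq; apply: run_assign; [small|small|]].
rewrite /= r0 r1 r2; set s1 := set_reg _ 9 _.
have k1 : keeps round_regs s0 s1 by do ?apply: keeps_set => //.
have inv1 : sweeping (ins m n) s1.
  right; split=> //=.
    split=> //=; first by rewrite covered_top.
    by rewrite v_size.
  by split=> // k ku; have [] := u_lt ku; lia.
apply: (run_while (I := fun s => keeps round_regs s0 s /\ sweeping (ins m n) s)
    (phi := fun s => 400 * reg s 6 + 60 * reg s 7)) => //.
- small.
- small.
- move=> s [ks inv] /= jpos; have [as0 rs] := ks.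
  apply: run_weaken.
    by apply: (run_clause _ _ inv jpos); rewrite ?as0 ?rs.
  move=> t s' [k' inv' ht]; split; last by lia.
  by split=> //; apply: keeps_trans ks k'.
move=> t s [ks inv] /= jz ht; split=> //; last by move: ht; rewrite /s1 /=; lia.
case: inv => [[-> _ _ _ ->]//|[[r9 pn D pend ST] cb bm]].
(* Without kept edges all remaining clauses are isolated and D is 0, so they fit for every [q]. *)
have j0 : reg s 6 = 0 by lia.
rewrite r9 -ST (ins_gap cb (b' := 0)) //.
- by rewrite j0 covered0 /= implybT ins0.
- by rewrite j0.
Qed.

End Sweep.

(** * The search for the least successful round *)

(** The edges are visited backwards, so that the value surviving at each vertex is its first
    edge. *)
Definition setup_code : prog :=
  Seq (Assign 6 (Reg 2))
  (WhileLeq (Defs.Num 1) (Reg 6)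
    (Seq (Assign 6 (Minus (Reg 6) (Defs.Num 1)))
    (Seq (Store 4 (Cell 1 (Reg 6)) (Reg 6)) (Store 5 (Cell 0 (Reg 6)) (Reg 6))))).

(** Tries [q] = 0, 1, 3, 7 and so on. Register 9 initially contains 0, which makes the loop
    start. *)
Definition gallop_code : prog :=
  WhileLeq (Reg 9) (Defs.Num 0)
    (Seq (Assign 3 (Reg 14))
    (Seq round_code
    (IfLeq (Reg 9) (Defs.Num 0)
      (Seq (Assign 13 (Plus (Reg 14) (Defs.Num 1)))
           (Assign 14 (Plus (Plus (Reg 14) (Reg 14)) (Defs.Num 1))))
      Skip))).

Definition bisect_code : prog :=
  WhileLeq (Plus (Reg 13) (Defs.Num 1)) (Reg 14)
    (Seq (Assign 3 (Half (Plus (Reg 13) (Reg 14))))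
    (Seq round_code
    (IfLeq (Reg 9) (Defs.Num 0)
      (Assign 13 (Plus (Reg 3) (Defs.Num 1)))
      (Assign 14 (Reg 3))))).

Definition greedy_code : prog :=
  Seq setup_code (Seq gallop_code (Seq bisect_code (Assign 0 (Reg 14)))).

Lemma first_index_step (l : seq nat) j (a : nat -> nat) : j < size l ->
  {in drop j.+1 l, forall y, a y = j.+1 + index y (drop j.+1 l)} ->
  {in drop j l, forall y,
    (if y == nth 0 l j then j else a y) = j + index y (drop j l)}.
Proof.
move=> jl h y; rewrite (drop_nth 0) // inE /=; case: eqVneq => [->|ne] /=.
  by rewrite addn0.
by move=> /h ->; lia.
Qed.

(** * The sweep on the actual graph, and the cost of the search *)

Section Implementation.

Variables (cla var : finType) (E : {set cla * var}).
Variables (cs : seq cla) (xs : seq var).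
Hypotheses (cs_perm : perm_eq cs (enum cla)) (xs_perm : perm_eq xs (enum var)).

Let m := size cs.
Let n := size xs.
Let u := edge_ranks E cs xs.
Let v := var_ranks E cs xs.

Variables (W M : nat).
Hypotheses (M_large : m + n + n + size u + 3 <= M) (W_large : 40 * M.+1 < W).

Lemma highest_step q C p : p <= n ->
  highest E cs xs q C p =
  if added_at E cs xs C p <= q then Some p
  else if p is p'.+1 then highest E cs xs q C p' else None.
Proof.
move=> pn; rewrite {1}/highest -[in rev _]addn1 iotaD rev_cat /= add0n.
rewrite edges_added_trial //; case: leqP => //= _; case: p pn => //=.
Qed.

(** Matching on [drop b cs] avoids a default clause, as [cla] may be empty. *)
Definition rank_added b p := if drop b cs is C :: _ then added_at E cs xs C p else 0.

(** Clauses are inserted from the top, so what remains to be inserted is always a reversed prefix of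
    [cs]. *)
Definition inserts q b p := isSome (insert_all E cs xs q (rev (take b cs)) p).

Lemma nth_clause b : b < m -> exists C,
  [/\ index C cs = b, take b.+1 cs = rcons (take b cs) C
    & forall p, rank_added b p = added_at E cs xs C p].
Proof.
move=> bm; have C0 : cla by move: bm; rewrite /m; case: (cs).
exists (nth C0 cs b); split; first by rewrite index_uniq ?(uniq_listing cs_perm).
  exact: take_nth.
by move=> p; rewrite /rank_added (drop_nth C0).
Qed.

Lemma inserts_in q b p : b < m -> p <= n -> rank_added b p <= q ->
  inserts q b.+1 p = inserts q b p.
Proof.
move=> /nth_clause [C [_ tk ra]] pn; rewrite ra /inserts tk rev_rcons /= => h.
by rewrite highest_step // h; case: insert_all.
Qed.

Lemma inserts_out q b p : b < m -> p <= n -> q < rank_added b p ->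
  inserts q b.+1 p = (0 < p) && inserts q b.+1 p.-1.
Proof.
move=> /nth_clause [C [_ tk ra]] pn; rewrite ra /inserts tk rev_rcons /= => h.
by rewrite highest_step // leqNgt h; case: p pn h.
Qed.

Lemma rank_added_cut b p st j : b < m -> p <= n -> cut u st b -> cut u j b.+1 ->
  rank_added b p + (j - st) =
  (if st < j then p - (nth (0, 0) u st).2 else 0) + covered u n j p.
Proof.
move=> /nth_clause [C [<- _ ->]] pn cst cj; exact: added_at_covered.
Qed.

Lemma edge_ranks_lt k : k < size u -> (nth (0, 0) u k).1 < m /\ (nth (0, 0) u k).2 < n.
Proof.
move=> ku; have [C [x [_ ->]]] := nth_edge_ranksP cs_perm xs_perm ku => /=.
by rewrite !index_mem !mem_listing.
Qed.

Lemma edge_ranks_sorted k k' : k <= k' < size u ->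
  (nth (0, 0) u k).1 <= (nth (0, 0) u k').1.
Proof.
case/andP; rewrite leq_eqVlt => /orP [/eqP ->//|kk'] k'u.
have /(pairwiseP (0, 0)) lex := edge_ranks_lex E cs_perm xs_perm.
have := lex k k'; rewrite !inE k'u (ltn_trans kk' k'u) kk' => /(_ isT isT isT).
by case/orP => [/ltnW//|/andP [/eqP ->]].
Qed.

Lemma var_ranks_nth g g' : g <= g' < size v -> nth 0 v g <= nth 0 v g'.
Proof.
case/andP; rewrite leq_eqVlt => /orP [/eqP ->//|gg'] gv.
have /(pairwiseP 0) srt := var_ranks_sorted E cs_perm xs_perm.
by apply: srt; rewrite ?inE // (ltn_trans gg' gv).
Qed.

Lemma size_var_ranks : size v = size u.
Proof. by rewrite size_edge_ranks // size_map size_edges_by_variable. Qed.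

Lemma run_greedy_round s0 : loaded u v (arr s0) -> reg s0 0 = m -> reg s0 1 = n ->
  reg s0 2 = size u -> reg s0 3 <= n + n + 1 ->
  run W M round_code s0 (fun t s =>
    [/\ keeps round_regs s0 s, reg s 9 = succeeds E cs xs (reg s0 3)
      & t <= 800 * (size u).+1]).
Proof.
move=> ld r0 r1 r2 r3.
have -> : succeeds E cs xs (reg s0 3) = inserts (reg s0 3) m n.
  by rewrite /succeeds /inserts take_size.
apply: (run_round (q := reg s0 3) (v := v) (added := rank_added)
  (ins := inserts (reg s0 3))) => //.
- exact: edge_ranks_lt.
- exact: edge_ranks_sorted.
- by move=> p; rewrite /inserts take0.
- exact: inserts_in.
- exact: inserts_out.
- exact: rank_added_cut.
- exact: var_ranks_nth.
- exact: mem_var_ranks.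
- exact: size_var_ranks.
Qed.

Lemma input_bounded : bounded M (input E cs xs).
Proof.
have le_index (T : eqType) (s : seq T) (f : cla * var -> T) l i :
    size s <= M -> nth 0 [seq index (f e) s | e <- l] i <= M.
  move=> sM; case: (ltnP i (size l)) => h; last by rewrite nth_default ?size_map.
  have [e0 _] : exists e0 : cla * var, True by case: l h => // e0; exists e0.
  by rewrite (nth_map e0) //; apply: leq_trans sM; apply: index_size.
have cM : size cs <= M by rewrite -/m; lia.
have xM : size xs <= M by rewrite -/n; lia.
split=> [[|[|[|r]]]|[|[|[|[|a]]]] i] /=; rewrite ?nth_nil //.
- by rewrite -(size_edge_ranks E cs_perm xs_perm) -/u; lia.
- by apply: (le_index _ cs (fun e => e.1)).
- by apply: (le_index _ xs (fun e => e.2)).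
- by apply: (le_index _ cs (fun e => e.1)).
- by apply: (le_index _ xs (fun e => e.2)).
Qed.

Lemma run_setup (s0 := input E cs xs) :
  run W M setup_code s0 (fun t s =>
    [/\ loaded u v (arr s), forall r, r != 6 -> reg s r = reg s0 r
      & t <= 50 * (size u).+1]).
Proof.
have a0 j : arr s0 0 j = (nth (0, 0) u j).1.
  rewrite /= /u /edge_ranks; case: (ltnP j (size (edges_by_clause E cs xs))) => h.
    have [e0 _] : exists e0 : cla * var, True by case: edges_by_clause h => // e0; exists e0.
    by rewrite !(nth_map e0).
  by rewrite !nth_default ?size_map.
have a1 j : arr s0 1 j = (nth (0, 0) u j).2.
  rewrite /= /u /edge_ranks; case: (ltnP j (size (edges_by_clause E cs xs))) => h.
    have [e0 _] : exists e0 : cla * var, True by case: edges_by_clause h => // e0; exists e0.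
    by rewrite !(nth_map e0).
  by rewrite !nth_default ?size_map.
have r2 : reg s0 2 = size u by rewrite /u size_edge_ranks.
pose I s := [/\ forall r, r != 6 -> reg s r = reg s0 r, reg s 6 <= size u,
  forall a i, a < 4 -> arr s a i = arr s0 a i,
  {in drop (reg s 6) [seq e.2 | e <- u], forall y,
     arr s 4 y = reg s 6 + index y (drop (reg s 6) [seq e.2 | e <- u])}
  & {in drop (reg s 6) [seq e.1 | e <- u], forall i,
     arr s 5 i = reg s 6 + index i (drop (reg s 6) [seq e.1 | e <- u])}].
apply: run_seq; apply: run_assign; [small|by rewrite [eval _ _]r2; lia|].
apply: (run_while (I := I) (phi := fun s => 50 * reg s 6)).
- small.
- small.
- split=> //=; first by move=> r /negbTE ->.
  + by rewrite -r2.
  + by move=> y; rewrite drop_oversize // size_map -r2.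
  + by move=> y; rewrite drop_oversize // size_map -r2.
- move=> s [rs ju as0 a4 a5] /= jpos.
  have ju' : reg s 6 - 1 < size u by lia.
  have jE : (reg s 6 - 1).+1 = reg s 6 by lia.
  apply: run_seq; apply: run_assign; [small|small|].
  apply: run_seq; apply: run_store; [small|small|small|].
  apply: run_store; [small|small|small|].
  split; last by rewrite /=; lia.
  split=> /=.
  + by move=> r rne; rewrite (negbTE rne) rs.
  + by lia.
  + by case=> [|[|[|[|a]]]] i //= _; apply: as0.
  + rewrite !as0 // a1 -(nth_map _ 0) //; apply: first_index_step; first by rewrite size_map.
    by rewrite jE.
  + rewrite !as0 // a0 -(nth_map _ 0) //; apply: first_index_step; first by rewrite size_map.
    by rewrite jE.
move=> t s [rs ju as0 a4 a5] /= jz ht; have j0 : reg s 6 = 0 by lia.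
rewrite j0 !drop0 in a4 a5; split=> //; last by move: ht r2; rewrite /= j0; lia.
split=> //.
- by move=> j; rewrite as0.
- by move=> j; rewrite as0.
- by move=> g; rewrite as0.
Qed.

Variables (k : nat).
Hypothesis (k_min : forall q, succeeds E cs xs q = (k <= q)).

Let kn : k <= n.
Proof. by rewrite -k_min; apply: succeeds_max. Qed.

Let L := trunc_log 2 (k + 2).
Let R := 800 * (size u).+1 + 50.

Definition searching (s : state) : Prop :=
  [/\ loaded u v (arr s), reg s 0 = m, reg s 1 = n & reg s 2 = size u].

Lemma searching_keeps s0 s : searching s0 -> keeps round_regs s0 s -> searching s.
Proof. by move=> [? ? ? ?] [as0 rs]; split; rewrite ?as0 ?rs. Qed.

Lemma run_gallop s0 : searching s0 -> reg s0 9 = 0 -> reg s0 13 = 0 -> reg s0 14 = 0 ->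
  run W M gallop_code s0 (fun t s =>
    [/\ searching s, reg s 13 <= k <= reg s 14, reg s 14 <= n + n + 1,
        reg s 14 - reg s 13 <= k & t <= R * (L + 2) + 10]).
Proof.
move=> srch0 r9 r13 r14.
(* The relation between registers 13 and 14 bounds the final interval by [k], and every tried value
   by twice the number of variables. *)
pose I s := [/\ searching s, reg s 13 <= k,
  reg s 9 = 0 \/ k <= reg s 14
  & (reg s 14 = 0 /\ reg s 13 = 0) \/ reg s 14 + 1 = reg s 13 + reg s 13].
(* A failed round doubles register 14 plus one and raises its logarithm by one; [small_log] below
   leaves a unit for the successful round. *)
pose phi s := R * (if reg s 9 <= 0 then L + 2 - trunc_log 2 (reg s 14).+1 else 0).
apply: (run_while (I := I) (phi := phi)).
- small.
- small.
- by split=> //; [lia|left|left].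
- move=> s [srch lo _ hi] /= h9.
  apply: run_seq; apply: run_assign; [small|small|].
  rewrite /=; apply: run_seq; apply: run_weaken.
    by case: srch => ld r0 r1 r2; apply: run_greedy_round => //=; lia.
  move=> t1 s1 [k1 r91 t1le]; rewrite k_min /= in r91.
  have srch1 : searching s1 by apply: searching_keeps k1.
  have [_ rs1] := k1.
  have e13 : reg s1 13 = reg s 13 by rewrite rs1.
  have e14 : reg s1 14 = reg s 14 by rewrite rs1.
  have phiE : phi s = R * (L + 2 - trunc_log 2 (reg s 14).+1) by rewrite /phi h9.
  have small_log : trunc_log 2 (reg s 14).+1 <= L + 1.
    have -> : L + 1 = trunc_log 2 (k + 2).*2 by rewrite trunc_log2_double ?addn1 //; lia.
    by apply: leq_trunc_log; lia.
  apply: run_if; [small|small| |] => /= h.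
    have kh : reg s 14 < k by move: h; rewrite r91; lia.
    apply: run_seq; apply: run_assign; [small|small|].
    apply: run_assign; [small|small|].
    split.
      case: srch1 => *; split=> //=; first lia; last by right; lia.
      by left; lia.
    rewrite phiE /phi /= h e14.
    have -> : (reg s 14 + reg s 14 + 1).+1 = (reg s 14).+1.*2 by lia.
    by rewrite trunc_log2_double //; move: t1le; rewrite /R; nia.
  apply: run_skip; split.
    split=> //; rewrite ?e13 ?e14 //; right; by move: h; rewrite r91; lia.
  by rewrite phiE /phi [_ <= 0]leqNgt h muln0; move: t1le; rewrite /R; nia.
move=> t s [srch lo done hi] /= h9 ht; split=> //; try lia.
move: ht; rewrite /phi [_ <= 0]leqNgt h9 muln0 r9 r14 /=; lia.
Qed.

Lemma run_bisect s0 : searching s0 -> reg s0 13 <= k <= reg s0 14 ->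
  reg s0 14 <= n + n + 1 -> reg s0 14 - reg s0 13 <= k ->
  run W M bisect_code s0 (fun t s => reg s 14 = k /\ t <= R * (L + 1) + 10).
Proof.
move=> srch0 h0 hn d0.
pose I s := [/\ searching s, reg s 13 <= k <= reg s 14 & reg s 14 <= n + n + 1].
(* The doubling gives an interval of length 1 logarithm 1, so that the halving to length 0 is paid
   for as well. *)
pose phi s := R * trunc_log 2 (reg s 14 - reg s 13).*2.
apply: (run_while (I := I) (phi := phi)).
- small.
- small.
- by split.
- move=> s [srch hk hi] /= lt.
  have half_le : (reg s 13 + reg s 14)./2 <= n + n + 1 by lia.
  apply: run_seq; apply: run_assign; [small|small|].
  rewrite /=; apply: run_seq; apply: run_weaken.
    by case: srch => ld r0 r1 r2; apply: run_greedy_round.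
  move=> t1 s1 [k1 r91 t1le]; rewrite k_min /= in r91.
  have srch1 : searching s1 by apply: searching_keeps k1.
  have [_ rs1] := k1.
  have e13 : reg s1 13 = reg s 13 by rewrite rs1.
  have e14 : reg s1 14 = reg s 14 by rewrite rs1.
  have e3 : reg s1 3 = (reg s 13 + reg s 14)./2 by rewrite rs1.
  have phiE d : d <= (reg s 14 - reg s 13)./2 -> R * (trunc_log 2 d.*2).+1 <= phi s.
    move=> hd; rewrite /phi [X in _ <= _ * X]trunc_log2_double; last lia.
    by apply: leq_mul => //; rewrite ltnS; apply: leq_trunc_log; lia.
  apply: run_if; [small|small| |] => /= h.
    have kh : (reg s 13 + reg s 14)./2 < k by move: h; rewrite r91; lia.
    apply: run_assign; [small|small|].
    split; first by case: srch1 => *; split=> //=; lia.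
    have hd : reg s1 14 - (reg s1 3 + 1) <= (reg s 14 - reg s 13)./2 by lia.
    by have := phiE _ hd; rewrite mulnS /phi /=; move: t1le; rewrite /R; lia.
  have kh : k <= (reg s 13 + reg s 14)./2 by move: h; rewrite r91; lia.
  apply: run_assign; [small|small|].
  split; first by case: srch1 => *; split=> //=; lia.
  have hd : reg s1 3 - reg s1 13 <= (reg s 14 - reg s 13)./2 by lia.
  by have := phiE _ hd; rewrite mulnS /phi /=; move: t1le; rewrite /R; lia.
move=> t s [srch hk hi] /= ge ht; split; first lia.
have : R * trunc_log 2 (reg s0 14 - reg s0 13).*2 <= R * (L + 1).
  rewrite leq_mul2l; apply/orP; right.
  have -> : L + 1 = trunc_log 2 (k + 2).*2 by rewrite trunc_log2_double ?addn1 //; lia.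
  by apply: leq_trunc_log; lia.
by move: ht; rewrite /phi; lia.
Qed.

Lemma run_greedy : run W M greedy_code (input E cs xs) (fun t s =>
  reg s 0 = k /\ t <= 50 * (size u).+1 + R * (2 * L + 3) + 30).
Proof.
apply: run_seq; apply: (run_weaken run_setup) => t1 s1 [ld rs t1le].
have srch : searching s1.
  by split=> //; rewrite rs // /u size_edge_ranks.
apply: run_seq; apply: run_weaken; first by apply: (run_gallop srch); rewrite rs.
move=> t2 s2 [srch2 h2 n2 d2 t2le].
apply: run_seq; apply: run_weaken; first exact: (run_bisect srch2 h2 n2 d2).
move=> t3 s3 [r14 t3le].
apply: run_assign; [small|by rewrite /= r14; lia|].
by split=> /=; [exact: r14|lia].
Qed.

End Implementation.

Lemma greedy_code_in_time : exists c : nat,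
   forall (cla var : finType) (E : {set cla * var})
          (cs : seq cla) (xs : seq var) (k : nat),
     perm_eq cs (enum cla) -> perm_eq xs (enum var) ->
     greedy_outputs E cs xs k ->
     computes_in_time E cs xs (c * (#|cla| + #|var| + #|E|).+1) greedy_code k
       (c * maxn 1 #|E| * trunc_log 2 (k + 2)).
Proof.
exists (100 * 100) => cla var E cs xs k csP xsP /(greedy_fromP E csP xsP) [_ kS kmin].
have k_min q : succeeds E cs xs q = (k <= q).
  case: leqP => h; first exact: (succeeds_mono csP xsP h).
  by apply/negbTE/kmin.
have cardc : #|cla| = size cs by rewrite cardE (perm_size csP).
have cardv : #|var| = size xs by rewrite cardE (perm_size xsP).
have cardE' : #|E| = size (edge_ranks E cs xs) by rewrite size_edge_ranks.
(* The word bound needs [40 * M.+1], at most 200 times the input size. For the time, [2 * L + 3] is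
   at most [5 * L] and [e.+1] at most twice [maxn 1 e], so the total factor stays below 10000. *)
set M := 4 * (size cs + size xs + size (edge_ranks E cs xs)).+1.
have [|||t [s [ex _ [r0 tle]]]] := @run_greedy cla var E cs xs csP xsP
  (100 * 100 * (#|cla| + #|var| + #|E|).+1) M _ _ k k_min.
- by rewrite /M; lia.
- by rewrite cardc cardv cardE' /M; lia.
- by apply: input_bounded => //; rewrite /M; lia.
exists t, s; split=> //; apply: leq_trans tle _.
have L1 : 1 <= trunc_log 2 (k + 2) by apply: trunc_log_max => //; lia.
rewrite cardE'; set e := size _; set L := trunc_log 2 _ in L1 *.
have eE : e.+1 <= 2 * maxn 1 e by lia.
nia.
Qed.

Theorem theorem13 :
  (forall (cla var : finType) (E : {set cla * var})
          (cs : seq cla) (xs : seq var),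
     perm_eq cs (enum cla) -> perm_eq xs (enum var) ->
     exists k, greedy_outputs E cs xs k /\ min_mergeable E cs xs k)
  /\
  (exists (P : prog) (c : nat),
     forall (cla var : finType) (E : {set cla * var})
            (cs : seq cla) (xs : seq var) (k : nat),
       perm_eq cs (enum cla) -> perm_eq xs (enum var) ->
       greedy_outputs E cs xs k ->
       computes_in_time E cs xs (c * (#|cla| + #|var| + #|E|).+1) P k
         (c * maxn 1 #|E| * trunc_log 2 (k + 2))).
Proof.
split; first by move=> *; apply: greedy_correct.
by exists greedy_code; exact: greedy_code_in_time.
Qed.
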